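(* Let $P$ be a finite poset, $n$ a natural number, and $\mathcal{J}$ a poset ideal in $\mathrm{Hom}(P,[n])$. The Alexander dual module $(\omega_{\Bbbk[\Delta(\mathcal{J})]})^*$ is the image of the natural map $$L(\mathcal{J})\to\Bbbk[x_{P\times[n]}]/B(\mathcal{J}),$$ and $\omega_{\Bbbk[\Delta(\mathcal{J})]}$ is the image of the natural map $$B(\mathcal{J})^A\to\Bbbk[x_{P\times[n]}]/L(\mathcal{J})^A=\Bbbk[\Delta(\mathcal{J})].$$ Hence both modules identify as ideals in the respective rings (with embeddings respecting the multigrading).
   Context: $\Bbbk$ is a field, $[n]=\{1<2<\dots<n\}$, $S=\Bbbk[x_{P\times[n]}]$ is the polynomial ring with variables $x_{p,i}$, graded by $\mathbb{N}^{P\times[n]}$; ''is'' means isomorphism of multigraded $S$-modules. $\mathrm{Hom}(P,[n])$ is the set of isotone (order-preserving) maps $P\to[n]$, a poset under the pointwise order. A poset ideal is a down-closed subset; $\mathcal{J}^c$ is the complement of $\mathcal{J}$ in $\mathrm{Hom}(P,[n])$. Put $m_{\Gamma\phi}=\prod_{p\in P}x_{p,\phi(p)}$. $L(\mathcal{J})$ (resp. $L(\mathcal{J}^c)$) is the ideal generated by all $m_{\Gamma\phi}$ with $\phi\in\mathcal{J}$ (resp. $\phi\in\mathcal{J}^c$). $B(P,n)$ is the ideal generated by the monomials $x_{p,i}x_{q,j}$ with $p<q$ and $i>j$, and $B(\mathcal{J})=L(\mathcal{J}^c)+B(P,n)$. The Alexander dual ideal $I^A$ of a squarefree monomial ideal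 $I$ is the ideal spanned by all monomials which have a non-trivial common divisor with every monomial in $I$. $\Delta(\mathcal{J})$ is the simplicial complex on $P\times[n]$ with Stanley–Reisner ideal $L(\mathcal{J})^A$; it is Cohen–Macaulay of codimension $|P|$, and the canonical module of its Stanley–Reisner ring is $\omega_{\Bbbk[\Delta(\mathcal{J})]}=\mathrm{Ext}^{|P|}_S(\Bbbk[\Delta(\mathcal{J})],S(-\mathbf 1))$, with $\mathbf 1$ the all-ones multidegree. A finitely generated $\mathbb{N}^{P\times[n]}$-graded $S$-module $M$ is squarefree if the multiplication $x_i:M_{\mathbf b}\to M_{\mathbf b+\epsilon_i}$ is an isomorphism whenever $b_i\ge1$ ($\epsilon_i$ the unit vectors). The Alexander dual module $M^*$ of a squarefree module $M$ is the squarefree module with $(M^* )_{\mathbf b}=\mathrm{Hom}_\Bbbk(M_{\mathbf 1-\mathbf b},\Bbbk)$ for every $0/1$-vector $\mathbf b$, where for $b_i=0$ the multiplication $x_i:(M^* )_{\mathbf b}\to(M^* )_{\mathbf b+\epsilon_i}$ is the dual of $x_i:M_{\mathbf 1-\mathbf b-\epsilon_i}\to M_{\mathbf 1-\mathbf b}$. *)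

(* Defs.v *)
From HB Require Import structures.
From mathcomp Require Import all_boot all_order all_algebra.
From mathcomp Require Import finmap boolp.
From mathcomp Require Import monalg.

Set Implicit Arguments.
Unset Strict Implicit.
Unset Printing Implicit Defensive.

Import GRing.Theory.
Local Open Scope ring_scope.

Section Submodules.
Variables (R : nzRingType) (V : lmodType R).

Definition submodule_prop (W : V -> Prop) : Prop :=
  [/\ W 0, forall u v, W u -> W v -> W (u + v)
    & forall a v, W v -> W (a *: v)].

Definition subm_pred (W : V -> Prop) (_ : submodule_prop W) : {pred V} :=
  fun v => `[< W v >].

Section Instance.
Variables (W : V -> Prop) (hW : submodule_prop W).

Lemma subm_predP v : reflect (W v) (v \in subm_pred hW).
Proof. exact: asboolP. Qed.

Fact subm_pred_closed : GRing.subsemimod_closed (subm_pred hW).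
Proof.
case: (hW) => W0 WD WZ; split.
  split; first exact/subm_predP.
  by move=> u v /subm_predP Wu /subm_predP Wv; apply/subm_predP/WD.
by move=> a v /subm_predP Wv; apply/subm_predP/WZ.
Qed.

HB.instance Definition _ :=
  GRing.isSubmodClosed.Build R V (subm_pred hW) subm_pred_closed.

Definition subm : submodClosed V := subm_pred hW.
End Instance.

Definition in_span (G : V -> Prop) (v : V) : Prop :=
  exists m (a : 'I_m -> R) (g : 'I_m -> V),
    (forall j, G (g j)) /\ v = \sum_j a j *: g j.

Fact span_subproof (G : V -> Prop) : submodule_prop (in_span G).
Proof.
split.
- exists 0, (fun=> 0), (fun=> 0); split; first by case.
  by rewrite big_ord0.
- move=> _ _ [m [a [g [Gg ->]]]] [m' [a' [g' [Gg' ->]]]].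
  exists (m + m')%N, (fun j => match split j with inl i => a i | inr i => a' i end),
    (fun j => match split j with inl i => g i | inr i => g' i end); split.
    by move=> j; case: (split j).
  rewrite big_split_ord /=; congr (_ + _); apply: eq_bigr => j _.
    by rewrite -[lshift m' j]/(unsplit (inl j)) unsplitK.
  by rewrite -[rshift m j]/(unsplit (inr j)) unsplitK.
- move=> b _ [m [a [g [Gg ->]]]]; exists m, (fun j => b * a j), g; split=> //.
  by rewrite scaler_sumr; apply: eq_bigr => j _; rewrite scalerA.
Qed.

Definition span (G : V -> Prop) : submodClosed V := subm (span_subproof G).

Fact addsub_subproof (W1 W2 : submodClosed V) :
  submodule_prop (fun v => exists v1 v2, [/\ v1 \in W1, v2 \in W2 & v = v1 + v2]).
Proof.
split.
- by exists 0, 0; rewrite !rpred0 addr0.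
- move=> _ _ [u1 [u2 [h1 h2 ->]]] [v1 [v2 [h3 h4 ->]]].
  by exists (u1 + v1), (u2 + v2); rewrite !rpredD // addrACA.
- move=> a _ [u1 [u2 [h1 h2 ->]]].
  by exists (a *: u1), (a *: u2); rewrite !rpredZ // scalerDr.
Qed.

Definition addsub (W1 W2 : submodClosed V) : submodClosed V :=
  subm (addsub_subproof W1 W2).

Fact zerosub_subproof : submodule_prop (fun v : V => v = 0).
Proof.
by split=> [|u v -> ->|a v ->] //; rewrite ?addr0 ?scaler0.
Qed.

Definition zerosub : submodClosed V := subm zerosub_subproof.

End Submodules.

Section KernelImage.
Variables (R : nzRingType) (U V : lmodType R) (f : {linear U -> V}).

Fact ker_subproof : submodule_prop (fun u : U => f u = 0).
Proof.
split=> [|u v /= fu fv|a v /= fv]; first exact: linear0.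
  by rewrite linearD fu fv addr0.
by rewrite linearZ_LR fv scaler0.
Qed.

Definition ker_sub : submodClosed U := subm ker_subproof.

Fact range_subproof : submodule_prop (fun v : V => exists u, v = f u).
Proof.
split=> [|_ _ [u ->] [v ->]|a _ [u ->]].
- by exists 0; rewrite linear0.
- by exists (u + v); rewrite linearD.
- by exists (a *: u); rewrite linearZ_LR.
Qed.

Definition range_sub : submodClosed V := subm range_subproof.
End KernelImage.

Section QuotientModule.
Variables (R : nzRingType) (V : lmodType R) (W : submodClosed V).
Local Open Scope quotient_scope.

Definition submod_type : Type := {v : V | v \in W}.
HB.instance Definition _ := SubType.on submod_type.
HB.instance Definition _ := Choice.on submod_type.
HB.instance Definition _ := [SubChoice_isSubLmodule of submod_type by <:].

(* Over a ring a submodule is also closed under opposites, but [submodClosed]  *)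
(* does not record it.                                                         *)
Definition zmod_pred : {pred V} := fun v => v \in W.
Fact zmod_pred_closed : zmod_closed zmod_pred.
Proof. exact: GRing.submod_closedB (submodClosedP W). Qed.
HB.instance Definition _ := GRing.isZmodClosed.Build V zmod_pred zmod_pred_closed.
Local Notation W0 := (zmod_pred : zmodClosed V).

Definition quot_type : Type := @Quotient.quot V W0.
HB.instance Definition _ := GRing.Zmodule.on quot_type.

Definition quot_pi (v : V) : quot_type := \pi_(@Quotient.quot V W0) v.
Definition quot_scale (a : R) (x : quot_type) : quot_type :=
  quot_pi (a *: repr (x : @Quotient.quot V W0)).

Lemma quot_piD : {morph quot_pi : u v / u + v}.
Proof. by move=> u v; rewrite /quot_pi (raddfD (\pi_(@Quotient.quot V W0))). Qed.

Lemma quot_piP u v : quot_pi u = quot_pi v <-> u - v \in W.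
Proof.
rewrite /quot_pi; split=> [/eqP|h]; first by rewrite -Quotient.idealrBE.
by apply/eqP; rewrite -Quotient.idealrBE.
Qed.

Lemma quot_piZ a v : quot_scale a (quot_pi v) = quot_pi (a *: v).
Proof.
apply/quot_piP; rewrite -scalerBr rpredZ //; apply/quot_piP.
by rewrite /quot_pi reprK.
Qed.

Lemma quot_pi_surj (x : quot_type) : exists v, x = quot_pi v.
Proof. by exists (repr (x : @Quotient.quot V W0)); rewrite /quot_pi reprK. Qed.

Fact quot_scaleA a b x : quot_scale a (quot_scale b x) = quot_scale (a * b) x.
Proof. by have [v ->] := quot_pi_surj x; rewrite !quot_piZ scalerA. Qed.
Fact quot_scale1 : left_id 1 quot_scale.
Proof. by move=> x; have [v ->] := quot_pi_surj x; rewrite quot_piZ scale1r. Qed.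
Fact quot_scaleDr : right_distributive quot_scale +%R.
Proof.
move=> a x y; have [u ->] := quot_pi_surj x; have [v ->] := quot_pi_surj y.
by rewrite -quot_piD !quot_piZ scalerDr quot_piD.
Qed.
Fact quot_scaleDl x : {morph quot_scale^~ x : a b / a + b}.
Proof.
move=> a b; have [u ->] := quot_pi_surj x.
by rewrite !quot_piZ scalerDl quot_piD.
Qed.

HB.instance Definition _ := GRing.Zmodule_isLmodule.Build R quot_type
  quot_scaleA quot_scale1 quot_scaleDr quot_scaleDl.

Fact quot_pi_linear : linear quot_pi.
Proof. by move=> a u v; rewrite quot_piD -quot_piZ. Qed.
HB.instance Definition _ := GRing.isLinear.Build R V quot_type *:%R quot_pi
  quot_pi_linear.
End QuotientModule.

Section NaturalMap.
Variables (R : nzRingType) (V : lmodType R) (W1 W2 : submodClosed V).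

Definition natural_map (w : submod_type W1) : quot_type W2 := quot_pi W2 (val w).

Fact natural_map_linear : linear natural_map.
Proof. by move=> a u v; rewrite /natural_map -linearP. Qed.
HB.instance Definition _ := GRing.isLinear.Build R (submod_type W1)
  (quot_type W2) *:%R natural_map natural_map_linear.
End NaturalMap.

(* the map Hom(R^r, N) -> Hom(R^r', N) induced by w |-> w *m D, homomorphisms  *)
(* out of a free module being given by their values on its basis               *)
Section Codifferential.
Variables (R : comNzRingType) (N : lmodType R) (r r' : nat) (D : 'M[R]_(r', r)).

Definition mx_codif (c : {ffun 'I_r -> N}) : {ffun 'I_r' -> N} :=
  [ffun u => \sum_v D u v *: c v].

Fact mx_codif_linear : linear mx_codif.
Proof.
move=> a c c'; apply/ffunP=> u; rewrite !ffunE scaler_sumr -big_split /=.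
apply: eq_bigr => v _; rewrite !ffunE scalerDr !scalerA; congr (_ *: _ + _).
by rewrite mulrC.
Qed.
HB.instance Definition _ := GRing.isLinear.Build R {ffun 'I_r -> N}
  {ffun 'I_r' -> N} *:%R mx_codif mx_codif_linear.
End Codifferential.

Section Multigraded.
Variables (k : fieldType) (I : finType).

Definition polyring := {malg k[cmonom I]}.
HB.instance Definition _ := GRing.ComNzRing.on polyring.
HB.instance Definition _ := GRing.Lmodule.on polyring.
Local Notation S := polyring.

Definition mono (m : cmonom I) : S := << m >>.
Definition X_ (i : I) : S := mono (ucm i).

(* Degrees live in Z^I, because Hom and Ext leave N^I. *)
Definition degree := {ffun I -> int}.
HB.instance Definition _ := GRing.Zmodule.on degree.

Definition unit_deg (i : I) : degree := [ffun j => (i == j)%:Z].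
Definition ones : degree := [ffun=> 1].

Definition poly_piece (b : degree) (f : S) : Prop :=
  forall m : cmonom I, f@_m != 0 -> forall i, (m i)%:Z = b i.

(* An S-module with a designated set of homogeneous elements in each degree;   *)
(* that these form a multigrading is the predicate [multigraded] below.        *)
Record gmodule := GModule {
  gcarrier :> lmodType S;
  piece : degree -> gcarrier -> Prop
}.
Arguments piece : clear implicits.

Definition kscale (M : lmodType S) (c : k) (m : M) : M := (c%:MP : S) *: m.

Definition multigraded (M : gmodule) : Prop :=
  [/\ forall b, [/\ piece M b 0,
        forall m m', piece M b m -> piece M b m' -> piece M b (m + m')
        & forall c m, piece M b m -> piece M b (kscale c m)],
      forall a b f m, poly_piece a f -> piece M b m -> piece M (a + b) (f *: m),
      forall m : M, exists (s : seq degree) (h : degree -> M),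
        (forall b, piece M b (h b)) /\ m = \sum_(b <- s) h b
    & forall (s : seq degree) (h : degree -> M), uniq s ->
        (forall b, piece M b (h b)) -> \sum_(b <- s) h b = 0 ->
        forall b, b \in s -> h b = 0].

Definition graded_iso (M N : gmodule) : Prop :=
  exists f : {linear M -> N},
    bijective f /\ forall b m, piece M b m <-> piece N b (f m).

(* S(-a), the free module with one generator, in degree a *)
Definition shifted (a : degree) : gmodule :=
  @GModule S^o (fun b f => poly_piece (b - a) f).
Definition Sgr : gmodule := shifted 0.

Definition gsub (M : gmodule) (W : submodClosed M) : gmodule :=
  @GModule (submod_type W) (fun b w => piece M b (val w)).

Definition gquot (M : gmodule) (W : submodClosed M) : gmodule :=
  @GModule (quot_type W) (fun b x => exists2 m, piece M b m & x = quot_pi W m).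

Definition natural_image (M : gmodule) (W1 W2 : submodClosed M) : gmodule :=
  @gsub (gquot W2) (range_sub (@natural_map S M W1 W2)).

(* F_i is the free module 'rV[S]_(rk i) whose v-th basis vector has degree     *)
(* dg v; the differential F_(i+1) -> F_i is w |-> w *m dif i.                  *)
Record free_resolution (M : gmodule) := FreeResolution {
  rk : nat -> nat;
  dg : forall i, 'I_(rk i) -> degree;
  aug : 'I_(rk 0) -> M;
  dif : forall i, 'M[S]_(rk i.+1, rk i);
  aug_homogeneous : forall v, piece M (dg v) (aug v);
  dif_homogeneous : forall i u v, poly_piece (dg u - dg v) (dif i u v);
  aug_surjective : forall m, exists w : 'rV[S]_(rk 0), m = \sum_v w 0 v *: aug v;
  exact_aug : forall w : 'rV[S]_(rk 0),
    \sum_v w 0 v *: aug v = 0 <-> exists u, w = u *m dif 0;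
  exact_dif : forall i (w : 'rV[S]_(rk i.+1)),
    w *m dif i = 0 <-> exists u, w = u *m dif i.+1
}.

Section Ext.
Variables (M : gmodule) (F : free_resolution M) (N : gmodule).

(* A homomorphism F_i -> N is given by its values on the basis of F_i.  It is  *)
(* homogeneous of degree b when it maps (F_i)_c to N_(b + c) for all c.        *)
Definition gHom (i : nat) : gmodule :=
  @GModule {ffun 'I_(rk F i) -> N}
    (fun b c => forall v, piece N (b + dg v) (c v)).

Definition codif (i : nat) : gHom i -> gHom i.+1 := mx_codif (N := N) (dif F i).
HB.instance Definition _ i := GRing.Linear.on (@codif i).

Definition cocycles (i : nat) : submodClosed (gHom i) := ker_sub (@codif i).
Definition coboundaries (i : nat) : submodClosed (gHom i) :=
  match i return submodClosed (gHom i) with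
  | 0 => zerosub _
  | j.+1 => range_sub (@codif j)
  end.

(* As coboundaries are cocycles, this is cocycles / coboundaries.              *)
Definition Ext (i : nat) : gmodule :=
  natural_image (cocycles i) (coboundaries i).
End Ext.

Definition squarefree (M : gmodule) : Prop :=
  [/\ multigraded M,
      forall (b : degree) m, piece M b m -> (exists i, b i < 0) -> m = 0,
      exists (r : nat) (g : 'I_r -> M), forall m, exists a : 'I_r -> S,
        m = \sum_j a j *: g j
    & forall (b : degree) i, 1 <= b i ->
        (forall m, piece M b m -> X_ i *: m = 0 -> m = 0) /\
        (forall m', piece M (b + unit_deg i) m' ->
           exists2 m, piece M b m & m' = X_ i *: m)].

(* the elements of Hom_k(M_b, k), as functions on M of which only the          *)
(* restriction to M_b matters                                                  *)
Definition functional (M : gmodule) (b : degree) (phi : M -> k) : Prop :=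
  forall c m m', piece M b m -> piece M b m' ->
    phi (kscale c m + m') = c * phi m + phi m'.

Definition zero_one (b : degree) : Prop := forall i, b i = 0 \/ b i = 1.

(* N is the Alexander dual module of M: for each 0/1-vector b, theta b is an   *)
(* isomorphism from N_b to Hom_k(M_(1-b), k), and the last clause says that    *)
(* multiplication by x_i on N corresponds to the transpose of that on M.       *)
Definition alexander_dual (M N : gmodule) : Prop :=
  [/\ squarefree M, squarefree N &
  exists theta : degree -> N -> M -> k,
  [/\ forall b, zero_one b -> forall y, piece N b y ->
        functional (ones - b) (theta b y),
      forall b, zero_one b -> forall c y y', piece N b y -> piece N b y' ->
        forall m, piece M (ones - b) m ->
        theta b (kscale c y + y') m = c * theta b y m + theta b y' m,
      forall b, zero_one b -> forall y, piece N b y ->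
        (forall m, piece M (ones - b) m -> theta b y m = 0) -> y = 0,
      forall b, zero_one b -> forall phi, functional (ones - b) phi ->
        exists2 y, piece N b y &
          forall m, piece M (ones - b) m -> theta b y m = phi m
    & forall (b : degree) i, zero_one b -> b i = 0 -> forall y m,
        piece N b y -> piece M (ones - b - unit_deg i) m ->
        theta (b + unit_deg i) (X_ i *: y) m = theta b y (X_ i *: m)]].

Definition ideal := submodClosed Sgr.

Definition nontrivial_common_divisor (m m' : cmonom I) : Prop :=
  exists d e e' : cmonom I, [/\ d <> mone, m = mmul d e & m' = mmul d e'].

Definition dual_ideal (A : ideal) : ideal :=
  span (V := Sgr) (fun f => exists2 m : cmonom I, f = mono m &
    forall m' : cmonom I, mono m' \in A -> nontrivial_common_divisor m m').

Definition set_mono (A : {set I}) : S := \prod_(i in A) X_ i.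

Definition sr_ideal (D : {set {set I}}) : ideal :=
  span (V := Sgr) (fun f => exists2 A : {set I}, A \notin D & f = set_mono A).

Definition sr_ring (D : {set {set I}}) : gmodule := gquot (sr_ideal D).

(* For a squarefree monomial ideal A, this is the complex with Stanley-Reisner *)
(* ideal A.                                                                    *)
Definition sr_complex (A : ideal) : {set {set I}} :=
  [set B : {set I} | set_mono B \notin A].

(* M is isomorphic, as a multigraded module, to an ideal of the ring S / A;    *)
(* the ideals of S / A are its S-submodules.                                   *)
Definition identifies_as_ideal (M : gmodule) (A : ideal) : Prop :=
  exists a : submodClosed (gquot A), graded_iso M (gsub a).

End Multigraded.

Section Letterplace.
Variables (k : fieldType) (disp : Order.disp_t) (P : finPOrderType disp) (n : nat).

Definition isotone (phi : {ffun P -> 'I_n}) : bool :=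
  [forall p, forall q, (p <= q)%O ==> (phi p <= phi q)%N].

Definition HomPn : finType := {phi : {ffun P -> 'I_n} | isotone phi}.

Definition poset_ideal (J : {set HomPn}) : Prop :=
  forall phi psi : HomPn, psi \in J ->
    (forall p, val phi p <= val psi p)%N -> phi \in J.

Definition var : finType := (P * 'I_n)%type.

(* m_(Gamma phi) *)
Definition graph_mono (phi : HomPn) : polyring k var :=
  \prod_(p : P) X_ k (p, val phi p : 'I_n).

Definition L_ideal (J : {set HomPn}) : ideal k var :=
  span (V := Sgr k var) (fun f => exists2 phi, phi \in J & f = graph_mono phi).

Definition BPn_ideal : ideal k var :=
  span (V := Sgr k var) (fun f => exists (p q : P) (i j : 'I_n),
    [/\ (p < q)%O, (j < i)%N & f = X_ k (p, i) * X_ k (q, j)]).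

Definition B_ideal (J : {set HomPn}) : ideal k var :=
  addsub (L_ideal (~: J)) BPn_ideal.

Definition Delta (J : {set HomPn}) : {set {set var}} :=
  sr_complex (dual_ideal (L_ideal J)).
End Letterplace.

(* Main.v *)
From HB Require Import structures.
From mathcomp Require Import all_boot all_order all_algebra.
From mathcomp Require Import finmap boolp.
From mathcomp Require Import monalg.
Require Import Defs.

(** For p in P put f_p = prod_i x_(p,i).  These monomials have disjoint
    supports, so they form a regular sequence; they lie in I = L(J)^A, and their
    degrees add up to the all-ones vector.  Computing Ext with a fixed free
    resolution F of S/I and changing only the second argument, the sequences
    0 -> S/(f_q : q in T) -> S/(f_q : q in T) -> S/(f_q : q in T + p) -> 0 shift
    degrees without loss, because each f_p acts as zero on cohomology.  This gives
    omega = Ext^|P|(S/I, S(-1)) = Hom(S/I, S/(f)) = ((f) : I)/(f), where (f) is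
    generated by all f_p, with no shift in the multigrading.

    A squarefree monomial lies in K = (f) : I iff it meets the graph of every map
    P -> [n] that is not in J, so that K /\ I = (f) and K + I = B(J)^A + I; hence
    omega = K/(f) = (B(J)^A + I)/I, the image of B(J)^A -> S/I.  The image of
    A -> S/B, for squarefree monomial ideals A and B, has a basis consisting of
    the monomials in A but not in B, and complementing supports shows that the
    image of B^A -> S/A^A is its Alexander dual. *)

Set Implicit Arguments.
Unset Strict Implicit.
Unset Printing Implicit Defensive.

Import GRing.Theory.
Local Open Scope ring_scope.

(** * Polynomials and monomials *)

(** The resolution [F] is arbitrary, so the only inputs are its exactness, the homogeneity of its
    differentials and its augmentation. Cochains for all the rings S/(f_q : q in T) are columns over
    S, read modulo an ideal, and isomorphisms are given by relations between representatives.
    Regularity is used only as cancellation of f_p, so n = 0, where f_p = 1, is no exception.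

    B(J) enters through maps that are not isotone. A set C containing the graph of such a map
    contains a pair (p,i), (q,j) with p < q and i > j. Conversely, given such a pair in C and the
    graph of some map in J inside C, changing two values of that map gives a map that is not isotone
    and has its graph in C. The second direction needs the map in J, which is why K and B(J)^A are
    compared only up to I.

    An Alexander dual is specified on 0/1 degrees only, so its uniqueness requires rebuilding the
    module: squarefreeness carries generators of the 0/1 pieces to all degrees, and directness of
    the grading recovers the homogeneous elements. *)

(* [coeff] and [restr] are locked because conversion otherwise unfolds
   polynomial products down to finite maps, which does not terminate in practice. *)
HB.lock Definition coeff (k : fieldType) (I : finType) (m : cmonom I)
  (f : polyring k I) : k := f@_m.

HB.lock Definition restr (k : fieldType) (I : finType) (Q : pred (cmonom I))
  (f : polyring k I) : polyring k I :=
  \sum_(m <- msupp f | Q m) << coeff m f *g m >>.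

Section Polynomials.
Variables (k : fieldType) (I : finType).
Local Notation S := (polyring k I).
Local Notation mon := (cmonom I).
Local Notation restr := (@restr k I).
Implicit Types (Q : pred mon) (f g : S) (m : mon) (A B : {set I}) (b : degree I).

Definition msup m : {set I} := [set i | m i != 0%N].
Definition degm m : degree I := [ffun i => (m i)%:Z].
Definition mset A : mon := \big[mmul/mone]_(i in A) ucm i.

Lemma cmonom_eqP m m' : (forall i, m i = m' i) -> m = m'.
Proof. by move=> h; apply/eqP/cmP. Qed.

Lemma degm_inj : injective degm.
Proof.
move=> m m' /ffunP h; apply: cmonom_eqP => i.
by have := h i; rewrite !ffunE => -[].
Qed.

Lemma degmM m m' : degm (mmul m m') = degm m + degm m'.
Proof. by apply/ffunP=> i; rewrite !ffunE cmM PoszD. Qed.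

Lemma mmulI m : injective (mmul m).
Proof.
by move=> m1 m2 e; apply: degm_inj; apply: (addrI (degm m)); rewrite -!degmM e.
Qed.

Lemma degm_ucm i : degm (ucm i) = unit_deg i.
Proof. by apply/ffunP=> j; rewrite !ffunE cmU. Qed.

Lemma msupM m m' : msup (mmul m m') = msup m :|: msup m'.
Proof. by apply/setP=> i; rewrite !inE cmM addn_eq0 negb_and. Qed.

Lemma msup_ucm i : msup (ucm i) = [set i].
Proof. by apply/setP=> j; rewrite !inE cmU (eq_sym j); case: (i == j). Qed.

Lemma msetE A i : mset A i = (i \in A) :> nat.
Proof.
rewrite /mset (big_morph (fun m : mon => m i) (id1 := 0%N) (op1 := addn)).
- case: (boolP (i \in A)) => [iA|iNA].
    rewrite (bigD1 i) //= cmUU big1 // => j /andP[_ /negbTE ji].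
    by rewrite cmU ji.
  rewrite big1 // => j jA; rewrite cmU; case: (j =P i) => // ji.
  by rewrite ji (negbTE iNA) in jA.
- by move=> m m'; rewrite cmM.
- by rewrite cm1.
Qed.

Lemma msup_mset A : msup (mset A) = A.
Proof. by apply/setP=> i; rewrite !inE msetE; case: (i \in A). Qed.

Lemma mset_div A m : A \subset msup m -> exists m', m = mmul (mset A) m'.
Proof.
move/subsetP=> sA; exists (divcm m (mset A)); apply: cmonom_eqP => i.
rewrite cmM divcmE msetE subnKC //.
by case: (boolP (i \in A)) => [/sA|]; rewrite ?inE -?lt0n.
Qed.

Lemma mset_setU1 i A : i \notin A -> mmul (ucm i) (mset A) = mset (i |: A).
Proof. by move=> iA; rewrite /mset big_setU1. Qed.

Lemma degm_surj b : (forall i, 0 <= b i) -> exists m, degm m = b.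
Proof.
move=> b0.
have [m mE] : exists m : mon, forall i, m i = `|b i|%N.
  have h0 i0 n : exists m : mon, forall i, m i = (if i == i0 then n else 0)%N.
    elim: n => [|n [m mE]].
      by exists mone => i; rewrite cm1 if_same.
    exists (mmul (ucm i0) m) => i; rewrite cmM cmU mE eq_sym.
    by case: eqP.
  have /choice [g gE] : forall i0, exists m : mon,
    forall i, m i = (if i == i0 then `|b i0| else 0)%N by move=> i0; exact: h0.
  exists (\big[mmul/mone]_i0 g i0) => i.
  rewrite (big_morph (fun m : mon => m i) (id1 := 0%N) (op1 := addn)); last 2 first.
  - by move=> m m'; rewrite cmM.
  - by rewrite cm1.
  rewrite (bigD1 i) //= gE eqxx big1 ?addn0 // => j ji.
  by rewrite gE eq_sym (negbTE ji).
by exists m; apply/ffunP => i; rewrite ffunE mE gez0_abs.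
Qed.

Lemma coeffE m f : coeff m f = f@_m.
Proof. by rewrite coeff.unlock. Qed.
Lemma coeffP f g : (forall m, coeff m f = coeff m g) -> f = g.
Proof. by move=> h; apply/malgP => m; have := h m; rewrite !coeffE. Qed.
Lemma coeffD m f g : coeff m (f + g) = coeff m f + coeff m g.
Proof. by rewrite !coeffE mcoeffD. Qed.
Lemma coeff0 m : coeff m (0 : S) = 0.
Proof. by rewrite coeffE mcoeff0. Qed.
Lemma coeffN m f : coeff m (- f) = - coeff m f.
Proof. by rewrite !coeffE mcoeffN. Qed.
Lemma coeffU m c m' : coeff m (<< c *g m' >> : S) = if m' == m then c else 0.
Proof. by rewrite coeffE mcoeffU; case: eqP. Qed.
Lemma coeffCM m c f : coeff m (c%:MP * f) = c * coeff m f.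
Proof. by rewrite !coeffE; exact: mcoeffCM. Qed.
Lemma coeff_msupp m f : (m \in msupp f) = (coeff m f != 0).
Proof. by rewrite coeffE -mcoeff_neq0. Qed.
Lemma polyE f : f = \sum_(m <- msupp f) << coeff m f *g m >>.
Proof. by rewrite {1}[f]monalgE; apply: eq_bigr => m _; rewrite coeffE. Qed.
Lemma coeffM_neq0 f g m : coeff m (f * g) != 0 ->
  exists m1 m2, [/\ coeff m1 f != 0, coeff m2 g != 0 & m = mmul m1 m2].
Proof.
rewrite -coeff_msupp => /msuppM_le[m1 [m2 [h1 h2 ->]]].
by exists m1, m2; rewrite -!coeff_msupp.
Qed.
Lemma poly_pieceE b f :
  poly_piece b f <-> forall m, coeff m f != 0 -> degm m = b.
Proof.
split=> h m; rewrite ?coeffE => mf.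
  by apply/ffunP=> i; rewrite ffunE (h m mf).
by move=> i; rewrite -(h m) ?coeffE // ffunE.
Qed.

Lemma coeff_sum (J : Type) (s : seq J) (Q : pred J) (F : J -> S) m :
  coeff m (\sum_(j <- s | Q j) F j) = \sum_(j <- s | Q j) coeff m (F j).
Proof. exact: (big_morph _ (coeffD m) (coeff0 m)). Qed.
Lemma coeffB m f g : coeff m (f - g) = coeff m f - coeff m g.
Proof. by rewrite coeffD coeffN. Qed.

Lemma coeffD_neq0 f g m : coeff m (f + g) != 0 -> coeff m f != 0 \/ coeff m g != 0.
Proof.
rewrite coeffD; case: (eqVneq (coeff m f) 0) => [->|]; last by left.
by rewrite add0r; right.
Qed.

Lemma poly_ind (P : S -> Prop) : P 0 -> (forall c m, P << c *g m >>) ->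
  (forall f g, P f -> P g -> P (f + g)) -> forall f, P f.
Proof.
by move=> P0 PU PD f; rewrite [f]polyE; elim/big_ind: _ => // *; apply: PU.
Qed.

Lemma mulUU c c' m m' :
  (<< c *g m >> : S) * << c' *g m' >> = << c * c' *g mmul m m' >>.
Proof. exact: fgmulUU. Qed.

Lemma monoM m m' : mono k (mmul m m') = mono k m * mono k m'.
Proof. by rewrite [RHS]mulUU mulr1. Qed.

Lemma mono1 : mono k (mone : mon) = 1.
Proof. by []. Qed.

Lemma set_monoE A : set_mono k A = mono k (mset A).
Proof. by rewrite /set_mono /mset (big_morph (@mono k I) monoM mono1). Qed.

Lemma monoZ c m : << c *g m >> = c%:MP * mono k m :> S.
Proof. by rewrite [RHS]mulUU mulr1 mul1m. Qed.

Lemma coeff_mono m m' : coeff m' (mono k m) = (m == m')%:R.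
Proof. by rewrite coeffU; case: eqP. Qed.

Lemma coeff_mono_neq0 m m' : coeff m' (mono k m) != 0 -> m' = m.
Proof. by rewrite coeff_mono; case: (m =P m') => //; rewrite eqxx. Qed.

Lemma coeff_monoM m f m' : coeff (mmul m m') (mono k m * f) = coeff m' f.
Proof.
elim/poly_ind: f => [|c m1|f g hf hg]; first by rewrite mulr0 !coeff0.
  by rewrite mulUU mul1r !coeffU (inj_eq (@mmulI m)).
by rewrite mulrDr !coeffD; congr (_ + _).
Qed.

Lemma coeff_monoM_neq0 m f m' : coeff m' (mono k m * f) != 0 ->
  exists2 m2, coeff m2 f != 0 & m' = mmul m m2.
Proof. by case/coeffM_neq0=> [m1 [m2 [/coeff_mono_neq0 -> h ->]]]; exists m2. Qed.

Lemma coeff_restr Q f m : coeff m (restr Q f) = if Q m then coeff m f else 0.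
Proof.
rewrite restr.unlock coeff_sum.
under eq_bigr => m' _ do rewrite coeffU.
case: (boolP (m \in msupp f)) => mf; last first.
  move: (mf); rewrite coeff_msupp negbK => /eqP ->; rewrite if_same.
  rewrite big_seq_cond big1 // => m' /andP[m'f _].
  by case: eqP => // e; rewrite e (negbTE mf) in m'f.
rewrite big_mkcond (bigD1_seq m mf (fset_uniq _)) /= eqxx big1 ?addr0 // => m'.
by move/negbTE => ->; rewrite if_same.
Qed.

Lemma restrD Q : {morph restr Q : f g / f + g}.
Proof.
move=> f g; apply/coeffP=> m; rewrite coeffD !coeff_restr coeffD.
by case: ifP; rewrite ?addr0.
Qed.
Lemma restr0 Q : restr Q 0 = 0.
Proof. by apply/coeffP=> m; rewrite coeff_restr coeff0 if_same. Qed.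
Lemma restrN Q f : restr Q (- f) = - restr Q f.
Proof. by apply/eqP; rewrite -addr_eq0 -restrD addNr restr0. Qed.
Lemma restrB Q f g : restr Q (f - g) = restr Q f - restr Q g.
Proof. by rewrite restrD restrN. Qed.
Lemma restr_sum Q (J : Type) (s : seq J) (F : J -> S) :
  restr Q (\sum_(j <- s) F j) = \sum_(j <- s) restr Q (F j).
Proof. exact: (big_morph _ (restrD Q) (restr0 Q)). Qed.

Lemma restr_id Q f : (forall m, coeff m f != 0 -> Q m) -> restr Q f = f.
Proof.
move=> h; apply/coeffP=> m; rewrite coeff_restr; case: ifP => // /negbT Qm.
by apply/eqP; rewrite eq_sym; apply: contraNT Qm; apply: h.
Qed.

Lemma coeff_restr_neq0 Q f m : coeff m (restr Q f) != 0 -> Q m /\ coeff m f != 0.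
Proof. by rewrite coeff_restr; case: ifP => //; rewrite eqxx. Qed.

(** The homogeneous component of degree [b]; it is 0 when [b] has a negative entry. *)
Definition hc b : S -> S := restr (fun m => degm m == b).

Lemma hc_piece b f : poly_piece b (hc b f).
Proof. by apply/poly_pieceE => m /coeff_restr_neq0 [/eqP]. Qed.

Lemma hc_id b f : poly_piece b f -> hc b f = f.
Proof. by move/poly_pieceE=> h; apply: restr_id => m /h ->. Qed.

Lemma restrCM Q c f : restr Q (c%:MP * f) = c%:MP * restr Q f.
Proof.
apply/coeffP=> m; rewrite coeffCM !coeff_restr coeffCM.
by case: ifP; rewrite ?mulr0.
Qed.

Lemma hc_monoM m b f : hc (degm m + b) (mono k m * f) = mono k m * hc b f.
Proof.
apply/coeffP=> m2; rewrite [LHS]coeff_restr.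
have [[m' ->]|nm] := EM (exists m', m2 = mmul m m').
  by rewrite [RHS]coeff_monoM coeff_restr coeff_monoM degmM (inj_eq (addrI _)).
have z h : coeff m2 (mono k m * h) = 0.
  by apply: contra_notP nm => /eqP/coeff_monoM_neq0[m' _ ->]; exists m'.
by rewrite [RHS]z; case: ifP => // _; apply: z.
Qed.

(** By linearity [f] may be taken to be a monomial of degree [a]. This is what makes homogeneous
    differentials commute with taking components. *)
Lemma hcM a b f g : poly_piece a f -> hc (a + b) (f * g) = f * hc b g.
Proof.
move/poly_pieceE=> fa; rewrite [f]polyE !mulr_suml /hc restr_sum.
rewrite big_seq [RHS]big_seq.
apply: eq_bigr => m; rewrite coeff_msupp => /fa <-.
rewrite monoZ -!mulrA; apply: (etrans (restrCM _ _ _)).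
congr (_ * _); exact: hc_monoM.
Qed.

Lemma sum_hc f : exists2 s : seq (degree I), uniq s & f = \sum_(b <- s) hc b f.
Proof.
exists (map degm (msupp f)).
  by rewrite map_inj_uniq ?fset_uniq //; exact: degm_inj.
rewrite big_map {1}[f]polyE; apply: eq_bigr => m _; apply/coeffP=> m'.
rewrite coeffU coeff_restr (inj_eq degm_inj) eq_sym.
by case: eqP => // ->.
Qed.

Lemma poly_piece0 b : poly_piece b (0 : S).
Proof. by apply/poly_pieceE=> m; rewrite coeff0 eqxx. Qed.
Lemma poly_pieceD b f g : poly_piece b f -> poly_piece b g -> poly_piece b (f + g).
Proof.
by move=> /poly_pieceE hf /poly_pieceE hg; apply/poly_pieceE=> m
  /coeffD_neq0[/hf|/hg].
Qed.
Lemma poly_pieceM a b f g : poly_piece a f -> poly_piece b g ->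
  poly_piece (a + b) (f * g).
Proof.
by move=> fa /hc_id <-; rewrite -(hcM _ _ fa); apply: hc_piece.
Qed.
Lemma poly_piece_mono m : poly_piece (degm m) (mono k m).
Proof. by apply/poly_pieceE=> m' /coeff_mono_neq0 ->. Qed.
Lemma poly_pieceC c : poly_piece 0 (c%:MP : S).
Proof.
apply/poly_pieceE=> m; rewrite coeffU; case: (mone =P m) => [<- _|]; last by rewrite eqxx.
by apply/ffunP=> i; rewrite !ffunE cm1.
Qed.
Lemma poly_piece_homog b f : poly_piece b f -> f != 0 ->
  exists m c, [/\ degm m = b, c != 0 & f = << c *g m >>].
Proof.
move=> /poly_pieceE h f0.
have [m mf] : exists m, coeff m f != 0.
  apply: contra_neqP f0 => /forallNP n; apply/coeffP=> m; rewrite coeff0.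
  by apply/eqP/negPn/negP/n.
exists m, (coeff m f); split; [exact: h | by [] | apply/coeffP=> m'].
rewrite coeffU; case: eqP => [-> //|ne]; apply/eqP/negPn/negP => m'f.
by apply: ne; apply: degm_inj; rewrite (h _ mf) (h _ m'f).
Qed.

End Polynomials.

(** * Squarefree monomial ideals *)

Section SquarefreeIdeals.
Variables (k : fieldType) (I : finType).
Local Notation S := (polyring k I).
Local Notation mon := (cmonom I).
Local Notation restr := (@restr k I).
Implicit Types (f g : S) (m : mon) (A B : {set I}) (W : ideal k I) (U : pred {set I}).

Lemma idealM W (f g : S) : (g : Sgr k I) \in W -> (f * g : Sgr k I) \in W.
Proof. by move=> h; exact: (rpredZ f h). Qed.

Lemma idealU W c m : (mono k m : Sgr k I) \in W -> (<< c *g m >> : Sgr k I) \in W.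
Proof. by rewrite monoZ; apply: idealM. Qed.

Lemma in_span_monoP (G : Sgr k I -> Prop) (Q : mon -> Prop) f :
  (forall f, G f <-> exists2 m, f = mono k m & Q m) ->
  (f : Sgr k I) \in Defs.span G <->
  (forall m, coeff m f != 0 -> exists2 m0, Q m0 & exists m1, m = mmul m0 m1).
Proof.
move=> GQ; split.
  move=> /subm_predP[r [a [g [Gg ->]]]] m.
  elim/big_ind: _ => [|u v hu hv|j _]; first by rewrite coeff0 eqxx.
    by case/coeffD_neq0=> [/hu|/hv].
  have /GQ[m0 -> Qm0] := Gg j.
  by case/coeffM_neq0=> [m1 [m2 [_ /coeff_mono_neq0 -> ->]]];
    exists m0 => //; exists m1; rewrite mulmC.
move=> h; rewrite [f]polyE big_seq.
apply: (@rpred_sum _ (Defs.span G)) => m; rewrite coeff_msupp => /h[m0 Qm0 [m1 e]].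
apply: idealU; rewrite e mulmC monoM; apply: idealM.
apply/subm_predP; exists 1%N, (fun=> 1), (fun=> mono k m0); split.
  by move=> _; apply/GQ; exists m0.
by rewrite big_ord1 scale1r.
Qed.

(** A squarefree monomial ideal is encoded by the family of supports of its monomials, so that sums,
    intersections, duals and colons of ideals become Boolean statements about families of sets. *)
Definition sqf W U : Prop := forall f,
  (f : Sgr k I) \in W <-> (forall m, coeff m f != 0 -> U (msup m)).

Lemma sqf_span (G : Sgr k I -> Prop) (Q : {set I} -> Prop) U :
  (forall f, G f <-> exists2 A, Q A & f = set_mono k A) ->
  (forall B, U B <-> exists2 A, Q A & A \subset B) -> sqf (Defs.span G) U.
Proof.
move=> GQ UQ f; rewrite (@in_span_monoP _ (fun m => exists2 A, m = mset A & Q A)).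
  split=> h m /h.
    case=> m0 [A -> QA [m1 ->]]; apply/UQ; exists A => //.
    by rewrite msupM msup_mset subsetUl.
  case/UQ=> A QA /mset_div[m' e]; exists (mset A); first by exists A.
  by exists m'.
move=> g; rewrite GQ; split=> [[A QA ->]|[m -> [A -> QA]]].
  by exists (mset A); [exact: set_monoE | exists A].
by exists A; rewrite // set_monoE.
Qed.

Lemma sqf_mono W U m : sqf W U -> (mono k m : Sgr k I) \in W <-> U (msup m).
Proof.
move=> WU; rewrite WU; split; last by move=> h m' /coeff_mono_neq0 ->.
by apply; rewrite coeff_mono eqxx oner_eq0.
Qed.

Lemma sqf_up W U A B : sqf W U -> A \subset B -> U A -> U B.
Proof.
move=> WU AB; rewrite -{1}(msup_mset A) => /(sqf_mono _ WU) h.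
have /mset_div[m' e] : A \subset msup (mset B) by rewrite msup_mset.
rewrite -(msup_mset B); apply/(sqf_mono _ WU).
by rewrite e mulmC monoM; apply: idealM.
Qed.

Lemma sqf_restr W U Q f : sqf W U -> (f : Sgr k I) \in W ->
  (restr Q f : Sgr k I) \in W.
Proof. by move=> WU /WU h; apply/WU => m /coeff_restr_neq0[_ /h]. Qed.

Lemma sqf_ext W1 W2 U : sqf W1 U -> sqf W2 U -> W1 =i W2.
Proof.
move=> h1 h2 f; apply/idP/idP => [/(h1 (f : S))/(h2 (f : S))|] //.
by move=> /(h2 (f : S))/(h1 (f : S)).
Qed.

Lemma sqf_addsub W1 W2 U1 U2 : sqf W1 U1 -> sqf W2 U2 ->
  sqf (addsub W1 W2) (fun A => U1 A || U2 A).
Proof.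
move=> h1 h2 f; split.
  move=> /subm_predP[f1 [f2 [/(h1 (f1 : S)) f1W /(h2 (f2 : S)) f2W ->]]] m.
  by case/coeffD_neq0=> [/f1W -> //|/f2W ->]; rewrite orbT.
move=> h; apply/subm_predP.
exists (restr (fun m => U1 (msup m)) f), (restr (fun m => ~~ U1 (msup m)) f); split.
- by apply/h1 => m /coeff_restr_neq0[].
- by apply/h2 => m /coeff_restr_neq0[/negbTE u /h]; rewrite u.
- apply/coeffP=> m; rewrite [RHS]coeffD !coeff_restr.
  by case: (U1 _); rewrite ?addr0 ?add0r.
Qed.

Lemma ncdP m m' : nontrivial_common_divisor m m' <->
  exists i, (i \in msup m) && (i \in msup m').
Proof.
split=> [[d [e [e' [d1 -> ->]]]]|[i /andP[im im']]].
  have [i di] : exists i, d i != 0%N.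
    apply: contra_notP d1 => /forallNP n; apply: cmonom_eqP => i.
    by rewrite cm1; apply/eqP/negPn/negP/n.
  by exists i; rewrite !msupM !inE di.
have h m1 : i \in msup m1 -> exists e, m1 = mmul (ucm i) e.
  move=> im1; have : [set i] \subset msup m1 by rewrite sub1set.
  by case/mset_div=> e ->; exists e; rewrite /mset big_set1.
have [e ->] := h _ im; have [e' ->] := h _ im'.
exists (ucm i), e, e'; split => // /(congr1 (fun m : mon => m i)).
by rewrite cmUU cm1.
Qed.

(** The largest support disjoint from that of [m] is the complement of [msup m]. As [U] is closed
    upwards, [m] meets all monomials of [W] iff this one support is not in [U]. *)
Lemma sqf_dual W U : sqf W U -> sqf (dual_ideal W) (fun A => ~~ U (~: A)).
Proof.
move=> WU f; rewrite (@in_span_monoP _ (fun m => forall m' : mon,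
  (mono k m' : Sgr k I) \in W -> nontrivial_common_divisor m m')) //.
split=> h m /h.
  case=> m0 hm0 [m1 ->]; apply/negP => hU.
  have /(sqf_mono _ WU)/hm0/ncdP[i] : U (msup (mset (~: msup (mmul m0 m1)))).
    by rewrite msup_mset.
  by rewrite msup_mset msupM !inE negb_or => /andP[-> /andP[]].
move=> hU; exists m; last by exists mone; rewrite mulm1.
move=> m' /(sqf_mono _ WU) hm'; apply/ncdP; apply: contra_notP (negP hU) => n.
apply: sqf_up WU _ hm'; apply/subsetP=> i im'; rewrite inE.
by apply/negP => im; apply: n; exists i; rewrite im im'.
Qed.

(** Passing to the complex and back loses nothing, because [W] is generated by its squarefree
    monomials. *)
Lemma sqf_sr W U : sqf W U -> sqf (sr_ideal k (sr_complex W)) U.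
Proof.
move=> WU; apply: (@sqf_span _ (fun A => U A)).
  have e A : (A \notin sr_complex W) = (set_mono k A \in W) by rewrite inE negbK.
  move=> f; split=> -[A].
    rewrite e set_monoE => /(sqf_mono _ WU); rewrite msup_mset => uA ->.
    by exists A; rewrite ?set_monoE.
  move=> uA ->; exists A => //; rewrite e set_monoE.
  by apply/(sqf_mono _ WU); rewrite msup_mset.
move=> B; split=> [uB|[A uA AB]]; first by exists B.
exact: sqf_up WU AB uA.
Qed.

Lemma sqf_monoM W U A f : sqf W U ->
  (set_mono k A * f : Sgr k I) \in W <->
  (forall m, coeff m f != 0 -> U (A :|: msup m)).
Proof.
move=> WU; rewrite set_monoE; split.
  move=> /(WU (_ * _)) h m mf; rewrite -{1}(msup_mset A) -msupM; apply: h.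
  by rewrite coeff_monoM.
move=> h; apply/(WU (_ * _)) => m /coeff_monoM_neq0[m' /h hm' ->].
by rewrite msupM msup_mset.
Qed.

End SquarefreeIdeals.

(** * Images of natural maps *)

Section NaturalImages.
Variables (k : fieldType) (I : finType).
Local Notation S := (polyring k I).
Implicit Types (M N : gmodule k I).

Section Classes.
Variables (M : gmodule k I) (W1 W2 : submodClosed M).
Local Notation NI := (natural_image W1 W2).

Definition ni_val (x : NI) : quot_type W2 :=
  val (x : submod_type (range_sub (@natural_map _ M W1 W2))).

Lemma ni_val_inj : injective ni_val.
Proof. exact: val_inj. Qed.

Fact ni_val_is_linear : linear ni_val.
Proof. by move=> a x y. Qed.

Lemma ni_valD x y : ni_val (x + y) = ni_val x + ni_val y.
Proof. by []. Qed.

Lemma ni_valZ a x : ni_val (a *: x) = a *: ni_val x.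
Proof. by []. Qed.

Lemma ni_repr (x : NI) : exists2 w, w \in W1 & ni_val x = quot_pi W2 w.
Proof.
have /subm_predP[u e] := valP (x : submod_type (range_sub (@natural_map _ M W1 W2))).
by exists (val u); [exact: (valP u) | exact: e].
Qed.

Lemma ni_mk w : w \in W1 -> exists x : NI, ni_val x = quot_pi W2 w.
Proof.
move=> w1.
have h : quot_pi W2 w \in range_sub (@natural_map _ M W1 W2).
  by apply/subm_predP; exists (exist (fun v => v \in W1) w w1).
by exists (exist (fun v => v \in range_sub (@natural_map S M W1 W2)) _ h).
Qed.

Lemma ni_pieceE b (x : NI) :
  piece b x <-> exists2 m, piece b m & ni_val x = quot_pi W2 m.
Proof. by []. Qed.

End Classes.

Lemma submodB M (W : submodClosed M) (x y : M) : x \in W -> y \in W -> x - y \in W.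
Proof. by move=> xW yW; rewrite -scaleN1r; apply: rpredD => //; apply: rpredZ. Qed.

Lemma submodBC M (W : submodClosed M) (x y : M) : (x - y \in W) = (y - x \in W).
Proof.
have h u v : u - v \in W -> v - u \in W.
  by move=> uv; rewrite -(opprB u v) -scaleN1r; apply: rpredZ.
by apply/idP/idP; apply: h.
Qed.

Lemma submodBr M (W : submodClosed M) (x y : M) : x - y \in W -> (x \in W) = (y \in W).
Proof.
move=> xy; apply/idP/idP => h; first by rewrite -(subKr x y); apply: submodB.
by rewrite -(subrK y x); apply: rpredD.
Qed.

Definition projector M (pr : degree I -> M -> M) : Prop :=
  [/\ forall b x y, pr b (x - y) = pr b x - pr b y,
      forall b x, piece b (pr b x)
    & forall b x, piece b x -> pr b x = x].

(* The relation rho stands for an isomorphism that is only defined on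
   representatives; compatibility with the projections onto the graded pieces
   makes it homogeneous in both directions. *)
Lemma graded_iso_of_rel M M' (W1 W2 : submodClosed M) (W1' W2' : submodClosed M')
    (pr : degree I -> M -> M) (pr' : degree I -> M' -> M') (rho : M -> M' -> Prop) :
  projector pr -> projector pr' ->
  (forall b x, x \in W2 -> pr b x \in W2) ->
  (forall b x, x \in W2' -> pr' b x \in W2') ->
  (forall b x y, rho x y -> rho (pr b x) (pr' b y)) ->
  (forall a x y x' y', rho x y -> rho x' y' -> rho (a *: x + x') (a *: y + y')) ->
  (forall x y, rho x y -> [/\ x \in W1, y \in W1' & (x \in W2) = (y \in W2')]) ->
  (forall x, x \in W1 -> exists y, rho x y) ->
  (forall y, y \in W1' -> exists x, rho x y) ->
  graded_iso (natural_image W1 W2) (natural_image W1' W2').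
Proof.
move=> [prB pr_piece pr_id] [prB' pr_piece' pr_id'] W2pr W2pr' rho_pr rhoL rhoW tot tot'.
have rhoB x y x' y' : rho x y -> rho x' y' -> rho (x - x') (y - y').
  move=> r r'; have := rhoL (-1) _ _ _ _ r' r.
  by rewrite !scaleN1r ![- _ + _]addrC.
have /choice[f fP] : forall x : natural_image W1 W2, exists y : natural_image W1' W2',
    exists w w', [/\ rho w w', ni_val x = quot_pi W2 w & ni_val y = quot_pi W2' w'].
  move=> x; have [w w1 xw] := ni_repr x; have [w' ww'] := tot _ w1.
  have [_ /(@ni_mk _ _ W2')[y yw'] _] := rhoW _ _ ww'.
  by exists y, w, w'.
(* The class of [f x] is independent of the chosen pair: the difference of two related pairs is
   related, hence lies in [W2] on one side iff it lies in [W2'] on the other. *)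
have fE x w w' : rho w w' -> ni_val x = quot_pi W2 w -> ni_val (f x) = quot_pi W2' w'.
  move=> ww' xw; have [v [v' [vv' xv ->]]] := fP x.
  have [_ _ e] := rhoW _ _ (rhoB _ _ _ _ vv' ww').
  by apply/quot_piP; rewrite -e; apply/quot_piP; rewrite -xv -xw.
have lf : linear f.
  move=> a x y; apply: ni_val_inj.
  have [v [v' [vv' xv fv]]] := fP x; have [w [w' [ww' xw fw]]] := fP y.
  rewrite (fE _ _ _ (rhoL a _ _ _ _ vv' ww')); last first.
    by rewrite ni_val_is_linear quot_pi_linear xv xw.
  by rewrite ni_val_is_linear quot_pi_linear fv fw.
have finj : injective f.
  move=> x y e; apply: ni_val_inj.
  have [v [v' [vv' -> fv]]] := fP x; have [w [w' [ww' -> fw]]] := fP y.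
  apply/quot_piP; have [_ _ ->] := rhoW _ _ (rhoB _ _ _ _ vv' ww').
  by apply/quot_piP; rewrite -fv -fw e.
have fsurj y : exists x, f x = y.
  have [w' w1 yw'] := ni_repr y; have [w ww'] := tot' _ w1.
  have [/(@ni_mk _ _ W2)[x xw] _ _] := rhoW _ _ ww'.
  by exists x; apply: ni_val_inj; rewrite (fE _ _ _ ww' xw).
have /choice[g gK] := fsurj.
pose F : {linear natural_image W1 W2 -> natural_image W1' W2'} :=
  HB.pack f (GRing.isLinear.Build _ _ _ _ f lf).
exists F; split; first by exists g => // x; apply: finj; rewrite gK.
move=> b x; rewrite !ni_pieceE /=.
have [w [w' [ww' xw fw]]] := fP x; rewrite xw fw.
(* As the projections preserve the submodules, the class of [w] has degree [b] iff [w - pr b w] lies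
   in [W2]; [e] carries this criterion over to [w']. *)
have [_ _ e] := rhoW _ _ (rhoB _ _ _ _ ww' (rho_pr b _ _ ww')).
split=> -[m mb /quot_piP wm].
  exists (pr' b w'); first exact: pr_piece'.
  apply/quot_piP; rewrite -e.
  have := W2pr b _ wm; rewrite prB (pr_id _ _ mb) => h.
  by rewrite -(subrKA m) rpredD // submodBC.
exists (pr b w); first exact: pr_piece.
apply/quot_piP; rewrite e.
have := W2pr' b _ wm; rewrite prB' (pr_id' _ _ mb) => h.
by rewrite -(subrKA m) rpredD // submodBC.
Qed.

Lemma graded_iso_trans M1 M2 M3 :
  graded_iso M1 M2 -> graded_iso M2 M3 -> graded_iso M1 M3.
Proof.
move=> [f [fb fp]] [g [gb gp]].
pose h : {linear M1 -> M3} := g \o f.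
by exists h; split; [exact: bij_comp | move=> b m; rewrite fp gp].
Qed.

Lemma graded_iso_sym M N : graded_iso M N -> graded_iso N M.
Proof.
move=> [f [[g fK gK] fp]].
have lg : linear g.
  by move=> a x y; apply: (can_inj fK); rewrite linearP !gK.
pose h : {linear N -> M} := HB.pack g (GRing.isLinear.Build _ _ _ _ g lg).
by exists h; split; [exists f | move=> b m; rewrite fp /= gK].
Qed.

End NaturalImages.

(** * Ext through regular sequences *)

Section Cochains.
Variables (R : comNzRingType) (rk : nat -> nat).
Variable D : forall i, 'M[R]_(rk i.+1, rk i).
Hypothesis exactD : forall i (w : 'rV[R]_(rk i.+1)),
  w *m D i = 0 <-> exists u, w = u *m D i.+1.
Local Notation ideal := (submodClosed R^o).
Implicit Types (a : ideal).

Lemma exact_comp i : D i.+1 *m D i = 0.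
Proof.
apply/row_matrixP => u; rewrite row0 row_mul; apply/exactD.
by exists (row u 1%:M); rewrite -row_mul mul1mx.
Qed.

Lemma exact_mx i p (A : 'M[R]_(p, rk i.+1)) :
  A *m D i = 0 -> exists B, A = B *m D i.+1.
Proof.
move=> AD.
have /choice[B BP] : forall u, exists b, row u A = b *m D i.+1.
  by move=> u; apply/exactD; rewrite -row_mul AD row0.
exists (\matrix_(u, v) B u 0 v); apply/row_matrixP => u.
by rewrite row_mul BP; congr (_ *m _); apply/rowP => v; rewrite !mxE.
Qed.

(* Multiplication by an f that kills the resolved module is null-homotopic; the
   homotopy s is extended one step at a time, so no sequence has to be chosen. *)
Lemma homotopy (f : R) :
  (exists s : 'M_(rk 0, rk 1), s *m D 0 = f%:M) ->
  forall i, exists s t, t *m D i.+1 + D i *m s = f%:M.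
Proof.
move=> [s0 s0P].
(* The hypothesis is all that the next step needs to know of the previous homotopy identity: by it,
   [f%:M - D i *m s] is annihilated by [D i], and exactness supplies [t]. *)
have step i (s : 'M_(rk i, rk i.+1)) : D i *m (f%:M - s *m D i) = 0 ->
    exists t, t *m D i.+1 + D i *m s = f%:M.
  move=> h; have [|t tP] := @exact_mx i _ (f%:M - D i *m s).
    by rewrite mulmxBl -mulmxA -scalar_mxC -mulmxBr.
  by exists t; rewrite -tP subrK.
have inv i : exists s : 'M_(rk i, rk i.+1), D i *m (f%:M - s *m D i) = 0.
  elim: i => [|i [s /step[t tP]]]; first by exists s0; rewrite s0P subrr mulmx0.
  exists t; rewrite -tP [t *m _ + _]addrC addrK mulmxA exact_comp mul0mx //.
by move=> i; have [s /step[t tP]] := inv i; exists s, t.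
Qed.

Definition mxin a r (c : 'cV[R]_r) : Prop := forall i, (c i 0 : R^o) \in a.

Lemma mxinD a r (c d : 'cV_r) : mxin a c -> mxin a d -> mxin a (c + d).
Proof. by move=> hc hd i; rewrite mxE; apply: (@rpredD _ a). Qed.
Lemma mxinZ a r x (c : 'cV_r) : mxin a c -> mxin a (x *: c).
Proof. by move=> hc i; rewrite mxE; apply: (@rpredZ _ _ a x). Qed.
Lemma mxinN a r (c : 'cV_r) : mxin a c -> mxin a (- c).
Proof. by move=> hc; rewrite -scaleN1r; apply: mxinZ. Qed.
Lemma mxinM a r s (A : 'M_(s, r)) (c : 'cV_r) : mxin a c -> mxin a (A *m c).
Proof.
by move=> hc i; rewrite mxE; apply: (@rpred_sum _ a) => j _; apply: (@rpredZ _ _ a).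
Qed.
Lemma mxin0 a r : mxin a (0 : 'cV_r).
Proof. by move=> i; rewrite mxE; apply: (@rpred0 _ a). Qed.
Lemma mxinBC a r (c d : 'cV_r) : mxin a (c - d) -> mxin a (d - c).
Proof. by rewrite -[d - c]opprB; apply: mxinN. Qed.
Lemma mxinB_trans a r (c d e : 'cV_r) :
  mxin a (c - d) -> mxin a (d - e) -> mxin a (c - e).
Proof. by move=> h h'; rewrite -(subrKA d); apply: mxinD. Qed.

(* A cochain with values in R/a is represented by a column over R, modulo a. *)
Definition cocyc a i (c : 'cV[R]_(rk i)) : Prop := mxin a (D i *m c).
Definition cobd a i : 'cV[R]_(rk i) -> Prop :=
  match i return 'cV[R]_(rk i) -> Prop with
  | 0 => fun c => mxin a c
  | j.+1 => fun c => exists e, mxin a (c - D j *m e)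
  end.

Lemma cocyc_linear a i x c c' : @cocyc a i c -> @cocyc a i c' -> cocyc a (x *: c + c').
Proof.
by move=> h h'; rewrite /cocyc mulmxDr -scalemxAr; apply: mxinD => //; apply: mxinZ.
Qed.

Lemma cobd_linear a i x c c' : @cobd a i c -> @cobd a i c' -> cobd a (x *: c + c').
Proof.
case: i c c' => [|i] c c' /= h h'; first by apply: mxinD => //; apply: mxinZ.
have [[e he] [e' he']] := (h, h'); exists (x *: e + e').
rewrite mulmxDr -scalemxAr opprD addrACA -scalerBr.
by apply: mxinD => //; apply: mxinZ.
Qed.

Lemma cobd0 a i : @cobd a i 0.
Proof.
case: i => [|i] /=; first exact: mxin0.
by exists 0; rewrite mulmx0 subr0; apply: mxin0.
Qed.

Definition vanish a i : Prop := forall c, @cocyc a i c -> @cobd a i c.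

Section Step.
Variable f : R.
Hypothesis f_htpy : exists s : 'M_(rk 0, rk 1), s *m D 0 = f%:M.

(** Apply the null-homotopy to [c]: the summand [t *m D i.+1] contributes an element of [a], the
    other one is the coboundary of [s *m c]. *)
Lemma cocyc_kill a i c : @cocyc a i.+1 c -> exists e, mxin a (f *: c - D i *m e).
Proof.
have [s [t st]] := homotopy f_htpy i.
move=> hc; exists (s *m c).
rewrite mulmxA -mul_scalar_mx -mulmxBl -st addrK -mulmxA; exact: mxinM.
Qed.

Variables (a a' : ideal).
Hypothesis f_reg : forall x : R, (f * x : R^o) \in a -> (x : R^o) \in a.
Hypothesis a'E : forall x : R, (x : R^o) \in a' <->
  exists y z : R, (y : R^o) \in a /\ x = y + f * z.

Lemma mxin_reg r (c : 'cV_r) : mxin a (f *: c) -> mxin a c.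
Proof. by move=> h i; apply: f_reg; have := h i; rewrite mxE. Qed.

Lemma mxin_sub r (c : 'cV_r) : mxin a c -> mxin a' c.
Proof. by move=> h i; apply/a'E; exists (c i 0), 0; rewrite mulr0 addr0; split. Qed.

Lemma mxin_f r (c : 'cV_r) : mxin a' (f *: c).
Proof.
move=> i; rewrite mxE; apply/a'E; exists 0, (c i 0).
by rewrite add0r; split=> //; apply: (@rpred0 _ a).
Qed.

Lemma mxin_split r (c : 'cV_r) : mxin a' c -> exists z, mxin a (c - f *: z).
Proof.
move=> h; have /choice[z zP] : forall i, exists z, (c i 0 - f * z : R^o) \in a.
  by move=> i; have /a'E[y [z [ya ->]]] := h i; exists z; rewrite addrK.
by exists (\col_i z i) => i; rewrite !mxE.
Qed.

(** On degree-0 cocycles multiplication by [f] is both zero, by the homotopy, and injective, by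
    regularity. *)
Lemma vanish0 : vanish a 0.
Proof.
move=> c hc; apply: mxin_reg; have [s sP] := f_htpy.
by rewrite -mul_scalar_mx -sP -mulmxA; apply: mxinM.
Qed.

(* c represents the connecting homomorphism of e for 0 -> R/a -> R/a -> R/a' -> 0,
   the first map being multiplication by f. *)
Definition linked i (e : 'cV[R]_(rk i)) (c : 'cV[R]_(rk i.+1)) : Prop :=
  mxin a (D i *m e - f *: c).

Lemma linked_linear i x e c e' c' :
  @linked i e c -> @linked i e' c' -> linked (x *: e + e') (x *: c + c').
Proof.
move=> h h'; rewrite /linked mulmxDr scalerDr opprD addrACA.
apply: mxinD => //; rewrite -scalemxAr scalerA mulrC -scalerA -scalerBr.
exact: mxinZ.
Qed.

Lemma linked_cocyc i e c : @linked i e c -> @cocyc a' i e /\ @cocyc a i.+1 c.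
Proof.
move=> h; split.
  rewrite /cocyc -(subrK (f *: c) (D i *m e)).
  by apply: mxinD; [apply: mxin_sub | apply: mxin_f].
(* Modulo [a], [f] times the differential of [c] is the differential of [D i *m e], which is 0; then
   [f] is cancelled. *)
apply: mxin_reg; rewrite scalemxAr -[f *: c](subKr (D i *m e)) mulmxBr.
by rewrite mulmxA exact_comp mul0mx sub0r; apply/mxinN/mxinM.
Qed.

Lemma linked_left i e : @cocyc a' i e -> exists c, @linked i e c.
Proof. exact: mxin_split. Qed.

(** Surjectivity of the connecting homomorphism: the next map of the long exact sequence is
    multiplication by [f], which is zero on cohomology. *)
Lemma linked_right i c : @cocyc a i.+1 c -> exists e, @linked i e c.
Proof. by move=> /cocyc_kill[e h]; exists e; apply: mxinBC. Qed.

Lemma linked_cobd_right i e c : @linked i e c -> @cobd a' i e -> @cobd a i.+1 c.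
Proof.
(* Up to a coboundary, [e] is [f *: z] modulo [a]. Hence [f *: c] and [f *: (D i *m z)] agree modulo
   [a], and cancelling [f] exhibits [c] as a coboundary. *)
have key (z : 'cV_(rk i)) : mxin a (D i *m e - f *: (D i *m z)) ->
    @linked i e c -> @cobd a i.+1 c.
  move=> h l; exists z; apply: mxin_reg; rewrite scalerBr.
  by apply: mxinB_trans h; apply: mxinBC.
case: i e c key => [|i] e c key l /= h.
  have [z zP] := mxin_split h; refine (key z _ l).
  by move: zP => /(mxinM (D 0)); rewrite mulmxBr scalemxAr; exact.
have [e' /mxin_split[z zP]] := h; refine (key z _ l).
move: zP => /(mxinM (D i.+1)).
by rewrite !mulmxBr mulmxA exact_comp mul0mx subr0 scalemxAr; exact.
Qed.

Lemma vanishS i : vanish a' i -> vanish a i.+1.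
Proof.
move=> v c /linked_right[e l]; apply: linked_cobd_right (l) _.
by apply: v; have [] := linked_cocyc l.
Qed.

(** Injectivity of the connecting homomorphism. If [c] is the coboundary of [z], then [e - f *: z]
    is a cocycle modulo [a], hence a coboundary by the vanishing hypothesis, and [f *: z] is 0
    modulo [a']. *)
Lemma linked_cobd_left i e c : vanish a i ->
  @linked i e c -> @cobd a i.+1 c -> @cobd a' i e.
Proof.
move=> v l [z zP].
have : @cocyc a i (e - f *: z).
  rewrite /cocyc mulmxBr -scalemxAr; apply: mxinB_trans l _.
  by rewrite -scalerBr; apply: mxinZ.
move/v; case: i e c l v z zP => [|i] e c l v z zP /=.
  by move=> h; rewrite -(subrK (f *: z) e); apply: mxinD;
    [apply: mxin_sub | apply: mxin_f].
case=> e' h; exists e'.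
rewrite -(subrK (f *: z) e) addrAC; apply: mxinD; last exact: mxin_f.
exact: mxin_sub.
Qed.

End Step.
End Cochains.

(** * Multidegrees of cochains and of the connecting isomorphism *)

Section GradedCochains.
Variables (k : fieldType) (I : finType).
Local Notation S := (polyring k I).
Variables (M : gmodule k I) (F : free_resolution M).
Local Notation D := (dif F).
Implicit Types (a : ideal k I) (b s : degree I).

Definition graded_ideal a : Prop :=
  forall b (f : S), (f : Sgr k I) \in a -> (hc b f : Sgr k I) \in a.

(** The degree-[b] component of a homomorphism out of F_i, which raises the degree of each basis
    vector by [b]. *)
Definition hcol b i (c : 'cV[S]_(rk F i)) : 'cV[S]_(rk F i) :=
  \col_v hc (b + dg (f := F) v) (c v 0).

Lemma hcB b (f g : S) : hc b (f - g) = hc b f - hc b g.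
Proof. exact: restrB. Qed.
Lemma hc_sum b (J : Type) (s : seq J) (f : J -> S) :
  hc b (\sum_(j <- s) f j) = \sum_(j <- s) hc b (f j).
Proof. exact: restr_sum. Qed.

Lemma hcolB b i (c d : 'cV_(rk F i)) : hcol b (c - d) = hcol b c - hcol b d.
Proof. by apply/colP=> v; rewrite !mxE hcB. Qed.

Lemma hcol_dif b i c : hcol b (D i *m c) = D i *m hcol b c.
Proof.
apply/colP=> u; rewrite [LHS]mxE [RHS]mxE [X in hc _ X]mxE hc_sum.
apply: eq_bigr => v _; rewrite [in RHS]mxE.
apply: etrans _ (hcM _ _ (@dif_homogeneous _ _ _ F i u v)); congr hc.
by rewrite addrCA subrK.
Qed.

Lemma hcol_scale b d i (f : S) (c : 'cV_(rk F i)) : poly_piece d f ->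
  hcol (b + d) (f *: c) = f *: hcol b c.
Proof.
move=> fd; apply/colP=> u.
rewrite [LHS]mxE [RHS]mxE [X in hc _ X]mxE [X in _ = _ * X]mxE.
by apply: etrans _ (hcM _ _ fd); congr hc; rewrite addrAC addrC.
Qed.

Lemma mxin_hcol a b i (c : 'cV_(rk F i)) : graded_ideal a ->
  mxin a c -> mxin a (hcol b c).
Proof. by move=> ga h v; rewrite mxE; apply: ga (h v). Qed.

Lemma cobd_hcol a b i c : graded_ideal a -> cobd D a c -> cobd D a (@hcol b i c).
Proof.
move=> ga; case: i c => [|i] c /=; first exact: mxin_hcol.
move=> [e h]; exists (hcol b e).
by rewrite -hcol_dif -hcolB; apply: mxin_hcol.
Qed.

(** This is Hom(F_i, S(s)). The columns do not depend on [s], so a shift changes the grading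
    alone. *)
Definition gcol s i : gmodule k I :=
  @GModule k I 'cV[S]_(rk F i)
    (fun b c => forall v, poly_piece (b + s + dg (f := F) v) (c v 0)).

Lemma gcol_projector s i :
  projector (M := gcol s i) (fun b c => hcol (b + s) (c : 'cV_(rk F i))).
Proof.
split=> [b x y|b x v|b x h]; first exact: hcolB.
  by rewrite mxE; apply: hc_piece.
by apply/colP=> v; rewrite mxE hc_id //; apply: h.
Qed.

Lemma submodule_prop_linear (V : lmodType S) (Q : V -> Prop) :
  Q 0 -> (forall x u v, Q u -> Q v -> Q (x *: u + v)) -> submodule_prop Q.
Proof.
move=> Q0 QL; split=> // [u v Qu Qv|x v Qv].
  by rewrite -[u]scale1r; apply: QL.
by rewrite -[_ *: _]addr0; apply: QL.
Qed.

Fact cocyc_subproof a s i : submodule_prop (V := gcol s i) (@cocyc S (rk F) D a i).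
Proof.
apply: submodule_prop_linear; last exact: cocyc_linear.
by rewrite /cocyc mulmx0; apply: mxin0.
Qed.

Fact cobd_subproof a s i : submodule_prop (V := gcol s i) (@cobd S (rk F) D a i).
Proof. by apply: submodule_prop_linear; [exact: cobd0 | exact: cobd_linear]. Qed.

(* Ext^i with values in S/a, shifted by s. *)
Definition cohom a s i : gmodule k I :=
  natural_image (subm (cocyc_subproof a s i)) (subm (cobd_subproof a s i)).

(** The connecting isomorphism. In a linked pair [D i *m e] is [f *: c] modulo [a], so [e] sits [d]
    degrees above [c]; this accounts for the shift [s + d]. *)
Lemma cohom_step (f : S) d s a a' i :
  poly_piece d f ->
  (exists t : 'M_(rk F 0, rk F 1), t *m D 0 = f%:M) ->
  (forall x : S, (f * x : Sgr k I) \in a -> (x : Sgr k I) \in a) ->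
  (forall x : S, (x : Sgr k I) \in a' <->
    exists y z : S, (y : Sgr k I) \in a /\ x = y + f * z) ->
  graded_ideal a -> graded_ideal a' -> vanish D a i ->
  graded_iso (cohom a s i.+1) (cohom a' (s + d) i).
Proof.
move=> fd ft freg a'E ga ga' van.
have ex := exact_dif (f := F).
apply: (@graded_iso_of_rel k I (gcol s i.+1) (gcol (s + d) i) _ _ _ _
  (fun b c => hcol (b + s) (c : 'cV_(rk F i.+1)))
  (fun b c => hcol (b + (s + d)) (c : 'cV_(rk F i)))
  (fun c e => @linked _ _ D f a i e c)).
- exact: gcol_projector.
- exact: gcol_projector.
- by move=> b x /subm_predP h; apply/subm_predP/cobd_hcol.
- by move=> b x /subm_predP h; apply/subm_predP/cobd_hcol.
- move=> b c e; rewrite /linked => h.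
  rewrite -hcol_dif addrA -(hcol_scale _ _ fd) -hcolB; exact: mxin_hcol.
- by move=> x c e c' e'; apply: linked_linear.
- move=> c e l; have [e1 c1] := linked_cocyc ex freg a'E l.
  split; try exact/subm_predP.
  apply/idP/idP => /subm_predP h; apply/subm_predP.
    exact: (linked_cobd_left a'E van l h).
  exact: (linked_cobd_right ex freg a'E l h).
- by move=> c /subm_predP/(linked_right ex ft).
- by move=> e /subm_predP/(linked_left a'E).
Qed.

End GradedCochains.

(** * Dimension shifting along the whole sequence *)

Section RegularSequence.
Variables (k : fieldType) (I : finType).
Local Notation S := (polyring k I).
Variables (M : gmodule k I) (F : free_resolution M).
Variables (P : finType) (f : P -> S) (d : P -> degree I) (a : {set P} -> ideal k I).
Hypothesis f_piece : forall p, poly_piece (d p) (f p).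
Hypothesis f_htpy : forall p,
  exists t : 'M_(rk F 0, rk F 1), t *m dif F 0 = (f p)%:M.
Hypothesis f_reg : forall p (T : {set P}), p \notin T -> forall x : S,
  (f p * x : Sgr k I) \in a T -> (x : Sgr k I) \in a T.
Hypothesis aU : forall p (T : {set P}), p \notin T -> forall x : S,
  (x : Sgr k I) \in a (p |: T) <->
  exists y z : S, (y : Sgr k I) \in a T /\ x = y + f p * z.
Hypothesis a_graded : forall T, graded_ideal (a T).

Lemma notin_card_lt (T : {set P}) : (#|T| < #|P|)%N -> exists p, p \notin T.
Proof.
move=> lt; have [//|n] := EM (exists p, p \notin T).
suff e : T = setT by rewrite e cardsT ltnn in lt.
by apply/setP=> p; rewrite inE; apply: contra_notT n => pT; exists p.
Qed.

Lemma regular_vanish i (T : {set P}) : (i + #|T| < #|P|)%N -> vanish (dif F) (a T) i.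
Proof.
elim: i T => [|i IH] T lt.
  have [p pT] := notin_card_lt lt.
  exact: (vanish0 (f_htpy p) (f_reg pT)).
have [|p pT] := @notin_card_lt T.
  by apply: leq_ltn_trans lt; apply: leq_addl.
apply: (vanishS (exact_dif (f := F)) (f_htpy p) (f_reg pT) (aU pT)).
by apply: IH; rewrite cardsU1 pT addnCA add1n -addSn.
Qed.

Lemma regular_cohom i (T : {set P}) s : (i + #|T| = #|P|)%N ->
  graded_iso (cohom F (a T) s i) (cohom F (a setT) (s + \sum_(p in ~: T) d p) 0).
Proof.
elim: i T s => [|i IH] T s e.
  have -> : T = setT by apply/eqP; rewrite eqEcard subsetT cardsT -e leqnn.
  rewrite setCT big_set0 addr0; apply: graded_iso_sym.
  by exists idfun; split=> //; exists idfun.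
have [|p pT] := @notin_card_lt T; first by rewrite -e addSn ltnS leq_addl.
have e' : (i + #|p |: T| = #|P|)%N by rewrite -e cardsU1 pT addnCA.
have van : vanish (dif F) (a T) i by apply: regular_vanish; rewrite -e.
have := cohom_step s (@f_piece p) (f_htpy p) (f_reg pT) (aU pT)
  (@a_graded T) (@a_graded (p |: T)) van.
move=> h; apply: graded_iso_trans h _.
have -> : s + \sum_(q in ~: T) d q = s + d p + \sum_(q in ~: (p |: T)) d q.
  rewrite (big_setD1 p) ?inE // addrA; congr (_ + _); apply: eq_bigl => q.
  by rewrite !inE negb_or.
exact: IH.
Qed.

End RegularSequence.

(** * Ext with values in a shifted copy of S as cohomology modulo the zero ideal *)

Section ExtCochains.
Variables (k : fieldType) (I : finType).
Local Notation S := (polyring k I).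
Variables (M : gmodule k I) (F : free_resolution M) (e : degree I).
Variable (a0 : ideal k I).
Hypothesis a0E : forall x : S, (x : Sgr k I) \in a0 <-> x = 0.
Local Notation N := (shifted k e).

Definition col_of r (c : {ffun 'I_r -> N}) : 'cV[S]_r := \col_v (c v : S).

Lemma col_of_inj r : injective (@col_of r).
Proof.
by move=> c d /colP h; apply/ffunP => v; have := h v; rewrite !mxE.
Qed.

Lemma col_of_linear r x (c d : {ffun 'I_r -> N}) :
  col_of (x *: c + d) = (x : S) *: col_of c + col_of d.
Proof. by apply/colP=> v; rewrite !mxE !ffunE. Qed.

Lemma col_of0 r : col_of (0 : {ffun 'I_r -> N}) = 0.
Proof. by apply/colP=> v; rewrite !mxE !ffunE. Qed.

Lemma col_of_surj r (y : 'cV[S]_r) : exists c, col_of c = y.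
Proof. by exists [ffun v => y v 0]; apply/colP=> v; rewrite mxE ffunE. Qed.

Lemma col_of_codif i (c : gHom F N i) :
  col_of (codif (c : gHom F N i)) = dif F i *m col_of c.
Proof.
apply/colP=> u; rewrite mxE [RHS]mxE ffunE; apply: eq_bigr => v _.
by rewrite mxE.
Qed.

Lemma mxin_a0 r (c : 'cV_r) : mxin a0 c <-> c = 0.
Proof.
split=> [h|->]; last exact: mxin0.
by apply/colP=> v; rewrite mxE; apply/a0E/(h v).
Qed.

Lemma cocyclesP i (c : gHom F N i) :
  c \in cocycles F N i <-> cocyc (dif F) a0 (col_of c).
Proof.
rewrite /cocyc mxin_a0 -col_of_codif; split.
  by move/subm_predP=> h; apply: etrans (congr1 (@col_of _) h) (col_of0 _).
by move=> h; apply/subm_predP/col_of_inj; apply: etrans h (esym (col_of0 _)).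
Qed.

Lemma coboundariesP i (c : gHom F N i) :
  c \in coboundaries F N i <-> cobd (dif F) a0 (col_of c).
Proof.
case: i c => [|i] c /=.
  rewrite mxin_a0; split.
    by move/subm_predP=> h; apply: etrans (congr1 (@col_of _) h) (col_of0 _).
  by move=> h; apply/subm_predP/col_of_inj; apply: etrans h (esym (col_of0 _)).
split.
  move/subm_predP=> [c' e']; exists (col_of c').
  rewrite (etrans (congr1 (@col_of _) e') (col_of_codif c')) subrr; exact: mxin0.
case=> y; have [c' <-] := col_of_surj y => /mxin_a0/eqP; rewrite subr_eq0 => /eqP h.
by apply/subm_predP; exists c'; apply: col_of_inj; apply: etrans h (esym (col_of_codif c')).
Qed.

Lemma a0_graded : graded_ideal a0.
Proof. by move=> b f /a0E ->; apply/a0E; apply: restr0. Qed.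

Lemma Ext_cohom i : graded_iso (Ext F N i) (cohom F a0 (- e) i).
Proof.
pose pr b (c : gHom F N i) : gHom F N i :=
  [ffun v => hc (b + - e + dg (f := F) v) (c v : S)].
have prE b c : col_of (pr b c) = hcol (b + - e) (col_of c).
  by apply/colP=> v; rewrite !mxE ffunE.
have dE b (v : 'I_(rk F i)) : b + dg (f := F) v - e = b + - e + dg (f := F) v.
  by rewrite addrAC.
apply: (@graded_iso_of_rel k I (gHom F N i) (gcol F (- e) i) _ _ _ _ pr
  (fun b c => hcol (b + - e) (c : 'cV_(rk F i)))
  (fun c y => c \in cocycles F N i /\ y = col_of c)).
- split=> [b x y|b x v|b x h].
  + apply: col_of_inj; have lB (u w : {ffun _ -> N}) : col_of (u - w) = col_of u - col_of w.
      by apply/colP=> v; rewrite !mxE !ffunE.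
    by rewrite lB !prE lB hcolB.
  + by rewrite /= dE ffunE; apply: hc_piece.
  + by apply/ffunP=> v; rewrite ffunE hc_id // -dE; apply: h.
- exact: gcol_projector.
- move=> b x /coboundariesP h; apply/coboundariesP; rewrite prE.
  exact: (cobd_hcol _ a0_graded h).
- by move=> b x /subm_predP h; apply/subm_predP; exact: (cobd_hcol _ a0_graded h).
- move=> b x _ [/cocyclesP h ->]; split; last by rewrite prE.
  apply/cocyclesP; rewrite prE /cocyc -hcol_dif; exact: (mxin_hcol _ a0_graded h).
- move=> x c _ c' _ [h ->] [h' ->]; split; last by rewrite col_of_linear.
  apply/cocyclesP; rewrite col_of_linear; apply: cocyc_linear; exact/cocyclesP.
- move=> c _ [h ->]; split; [exact: h | exact/subm_predP/cocyclesP |].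
  apply/idP/idP; first by move/coboundariesP=> ?; apply/subm_predP.
  by move/subm_predP=> ?; apply/coboundariesP.
- by move=> c h; exists (col_of c).
- move=> y /subm_predP; have [c <-] := col_of_surj y => h.
  by exists c; split=> //; apply/cocyclesP.
Qed.

End ExtCochains.

(** * Hom(S/W, S/a) as the quotient of the colon ideal by a *)

Section ZerothCohomology.
Variables (k : fieldType) (I : finType).
Local Notation S := (polyring k I).
Variables (W : ideal k I) (F : free_resolution (gquot W)).

Lemma quot_pi_eq0 (x : S) : quot_pi W (x : Sgr k I) = 0 <-> (x : Sgr k I) \in W.
Proof.
have -> : 0 = quot_pi W 0 by rewrite linear0.
by rewrite quot_piP subr0.
Qed.

Lemma aug_lift : exists g : 'I_(rk F 0) -> S, forall v,
  poly_piece (dg (f := F) v) (g v) /\ aug (f := F) v = quot_pi W (g v : Sgr k I).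
Proof.
have /choice[g gP] : forall v, exists g : S, poly_piece (dg (f := F) v) g /\
    aug (f := F) v = quot_pi W (g : Sgr k I).
  move=> v; have [g h e] := @aug_homogeneous _ _ _ F v.
  by exists g; split=> //; move: h; rewrite /= subr0.
by exists g.
Qed.
Variable g : 'I_(rk F 0) -> S.
Hypothesis g_piece : forall v, poly_piece (dg (f := F) v) (g v).
Hypothesis g_aug : forall v, aug (f := F) v = quot_pi W (g v : Sgr k I).

Lemma aug_sum (w : 'rV[S]_(rk F 0)) :
  \sum_v w 0 v *: aug (f := F) v = quot_pi W (\sum_v w 0 v * g v : Sgr k I).
Proof.
rewrite linear_sum; apply: eq_bigr => v _.
by rewrite g_aug; symmetry; apply: linearZ.
Qed.

Lemma aug_exact (w : 'rV[S]_(rk F 0)) :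
  (\sum_v w 0 v * g v : Sgr k I) \in W <-> exists u, w = u *m dif F 0.
Proof. by rewrite -exact_aug aug_sum quot_pi_eq0. Qed.

Lemma aug_unit : exists w : 'rV[S]_(rk F 0),
  (1 - \sum_v w 0 v * g v : Sgr k I) \in W.
Proof.
have [w e] := aug_surjective F (quot_pi W (1 : Sgr k I)).
by exists w; apply/quot_piP; rewrite e aug_sum.
Qed.

(** The start of the homotopy: [x] kills S/W, so [x] times each basis vector augments to 0 and lifts
    through the first differential. *)
Lemma aug_htpy (x : S) : (x : Sgr k I) \in W ->
  exists t : 'M_(rk F 0, rk F 1), t *m dif F 0 = x%:M.
Proof.
move=> xW.
have /choice[t tP] : forall v, exists u : 'rV_(rk F 1), row v x%:M = u *m dif F 0.
  move=> v; apply/aug_exact; rewrite (bigD1 v) //= big1 => [|v' nv].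
    rewrite addr0 !mxE eqxx mulr1n mulrC; exact: idealM.
  by rewrite !mxE eq_sym (negbTE nv) mul0r.
exists (\matrix_(v, u) t v 0 u); apply/row_matrixP => v.
by rewrite row_mul tP; congr (_ *m _); apply/rowP => u; rewrite !mxE.
Qed.

Variables (a K : ideal k I).
Hypothesis a_graded : graded_ideal a.
Hypothesis K_graded : graded_ideal K.
Hypothesis KE : forall s : S, (s : Sgr k I) \in K <->
  forall h : S, (h : Sgr k I) \in W -> (h * s : Sgr k I) \in a.

Lemma dot_in (w : 'rV[S]_(rk F 0)) (c : 'cV[S]_(rk F 0)) :
  cocyc (dif F) a (c : 'cV_(rk F 0)) -> (\sum_v w 0 v * g v : Sgr k I) \in W ->
  ((w *m c) 0 0 : Sgr k I) \in a.
Proof.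
by move=> h /aug_exact[u ->]; rewrite -mulmxA; apply: (@mxinM S a _ _ u).
Qed.

(** A homomorphism from S/W to S/a is multiplication by the image [s] of 1. Composed with the
    augmentation, it sends the basis vector [v] to [s * g v]. *)
Definition evaluation (c : 'cV[S]_(rk F 0)) (s : S) : Prop :=
  (s : Sgr k I) \in K /\ mxin a (c - s *: \col_v g v).

Lemma evaluation_linear (x : S) c s c' s' :
  evaluation c s -> evaluation c' s' -> evaluation (x *: c + c') (x * s + s').
Proof.
move=> [sK h] [sK' h']; split.
  by apply: (@rpredD _ K) => //; apply: idealM.
rewrite scalerDl opprD addrACA -scalerA -scalerBr.
exact: (mxinD (mxinZ x h) h').
Qed.

Lemma evaluation_cocyc c s : evaluation c s -> cocyc (dif F) a (c : 'cV_(rk F 0)).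
Proof.
move=> [/KE sK h]; rewrite /cocyc -(subrK (s *: \col_v g v) c) mulmxDr.
apply: mxinD; first exact: mxinM.
rewrite -scalemxAr => u; rewrite mxE mulrC; apply: sK.
rewrite [X in X \in _](_ : _ = \sum_v (row u (dif F 0)) 0 v * g v).
  by apply/aug_exact; exists (delta_mx 0 u); rewrite rowE.
by rewrite mxE; apply: eq_bigr => v _; rewrite !mxE.
Qed.

Lemma cohom0_colon : graded_iso (cohom F a 0 0) (natural_image (M := Sgr k I) K a).
Proof.
have [w wP] := aug_unit.
have colg s : s *: (\col_v g v) = \col_v (s * g v) :> 'cV[S]_(rk F 0).
  by apply/colP=> v; rewrite [LHS]mxE [RHS]mxE [X in _ * X]mxE.
apply: (@graded_iso_of_rel k I (gcol F 0 0) (Sgr k I) _ _ _ _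
  (fun b c => hcol (b + 0) (c : 'cV_(rk F 0))) (fun b (s : S) => hc b s)
  (fun c s => evaluation c s)).
- exact: gcol_projector.
- by split=> [b x y|b x|b x h]; [exact: hcB | rewrite /= subr0; exact: hc_piece |
    apply: hc_id; move: h; rewrite /= subr0].
- by move=> b x /subm_predP h; apply/subm_predP; exact: (cobd_hcol _ a_graded h).
- by move=> b x; apply: a_graded.
- move=> b c s [sK h]; split; first exact: K_graded.
  rewrite (_ : _ - _ = hcol (b + 0) (c - s *: \col_v g v)); first exact: mxin_hcol.
  rewrite hcolB; congr (_ - _); rewrite !colg; apply/colP=> v.
  rewrite [LHS]mxE [RHS]mxE [X in _ = hc _ X]mxE addr0 addrC.
  rewrite [LHS]mulrC [X in _ = hc _ X]mulrC.
  by apply/esym/hcM/g_piece.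
- by move=> x c s c' s'; apply: evaluation_linear.
- move=> c s cs; have [sK h] := cs; have cc := evaluation_cocyc cs; split=> //.
    exact/subm_predP.
  apply/idP/idP => [/subm_predP /= ca|sa]; last first.
    apply/subm_predP => /=; rewrite -(subrK (s *: \col_v g v) c).
    by apply: mxinD => // v; rewrite !mxE mulrC; apply: idealM.
  have sg v : (s * g v : Sgr k I) \in a.
    have := mxinBC h; move/mxinD => /(_ _ ca); rewrite subrK => /(_ v).
    by rewrite !mxE.
  (* Split 1 as an element of [W] plus a combination of the [g v]: the first part times [s] is in
     [a] because [s] is in [K], the second because each [s * g v] is. *)
  rewrite -[s]mul1r -(subrK (\sum_v w 0 v * g v) 1) mulrDl.
  apply: (@rpredD _ a); first by move/KE: sK; apply.
  rewrite mulr_suml; apply: (@rpred_sum _ a) => v _.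
  by rewrite -mulrA [g v * _]mulrC; apply: idealM.
(* Since [w] lifts 1 along the augmentation, [w *m c] is the value at 1 of the homomorphism given by
   [c]. *)
- move=> c /subm_predP cc; exists ((w *m (c : 'cV_(rk F 0))) 0 0); split.
    apply/KE => h hW; rewrite (_ : h * _ = ((h *: w) *m c) 0 0).
      apply: dot_in => //.
      rewrite (_ : \sum_v _ = h * \sum_v w 0 v * g v).
        rewrite mulrC; exact: idealM.
      by rewrite mulr_sumr; apply: eq_bigr => v _; rewrite mxE mulrA.
    by rewrite -scalemxAl [RHS]mxE.
  (* The basis vector [v] and [g v *: w] have the same augmentation, so a cocycle takes the same
     value on both modulo [a]. *)
  move=> v; suff -> : ((c : 'cV_(rk F 0)) - (w *m (c : 'cV_(rk F 0))) 0 0 *: \col_v g v) v 0 =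
      ((delta_mx 0 v - g v *: w) *m (c : 'cV_(rk F 0))) 0 0.
    apply: dot_in cc _.
    rewrite (_ : \sum_j _ = g v * (1 - \sum_v w 0 v * g v)); first exact: idealM.
    rewrite mulrBr mulr1 mulr_sumr.
    transitivity (\sum_j ((delta_mx 0 v : 'rV[S]_(rk F 0)) 0 j * g j -
                           g v * (w 0 j * g j))).
      apply: eq_bigr => j _.
      by rewrite [in LHS]mxE [X in _ + X]mxE [X in - X]mxE mulrBl mulrA.
    rewrite sumrB; congr (_ - _); rewrite (bigD1 v) //= big1 => [|j jv].
      by rewrite mxE !eqxx mul1r addr0.
    by rewrite mxE (negbTE jv) mul0r.
  rewrite mulmxBl -scalemxAl -rowE [LHS]mxE [RHS]mxE; congr (_ + _).
    by rewrite mxE.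
  rewrite [LHS]mxE [RHS]mxE; congr (- _).
  by rewrite [LHS]mxE [RHS]mxE [X in _ * X = _]mxE mulrC.
- move=> s sK; exists (s *: \col_v g v); split=> //.
  by rewrite subrr; apply: mxin0.
Qed.

End ZerothCohomology.

(** * Alexander duality *)

Section NormalForm.
Variables (k : fieldType) (I : finType).
Local Notation S := (polyring k I).
Local Notation restr := (@restr k I).
Variables (W1 W2 : ideal k I) (U1 U2 : pred {set I}).
Hypotheses (h1 : sqf W1 U1) (h2 : sqf W2 U2).
Local Notation N := (natural_image (M := Sgr k I) W1 W2).
Implicit Types (x y : N) (f : S) (m : cmonom I) (b : degree I).

Let V (A : {set I}) := U1 A && ~~ U2 A.

Lemma nf_ex x : exists f, ni_val x = quot_pi W2 (f : Sgr k I) /\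
  (forall m, coeff m f != 0 -> V (msup m)).
Proof.
have [w w1 e] := ni_repr x; set w' : S := w.
exists (restr (fun m => ~~ U2 (msup m)) w'); split.
  rewrite e; apply/quot_piP/(h2 (w' - _)) => m.
  rewrite coeffB coeff_restr; case: ifP => [_|/negbFE //].
  by rewrite subrr eqxx.
by move=> m /coeff_restr_neq0[u /((h1 w').1 w1) u1]; rewrite /V u1.
Qed.

(* The representative of x supported on monomials of W1 outside W2. *)
Definition nf x : S := sval (cid (nf_ex x)).

Lemma nf_val x : ni_val x = quot_pi W2 (nf x : Sgr k I).
Proof. by have [] := svalP (cid (nf_ex x)). Qed.

Lemma nf_supp x m : coeff m (nf x) != 0 -> V (msup m).
Proof. by have [_] := svalP (cid (nf_ex x)); apply. Qed.

Lemma nfE x f : ni_val x = quot_pi W2 (f : Sgr k I) ->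
  nf x = restr (fun m => ~~ U2 (msup m)) f.
Proof.
rewrite nf_val => /quot_piP/(h2 (nf x - f)) h; apply/coeffP => m.
rewrite coeff_restr; case: ifP => [u|/negbFE u].
  apply/eqP; rewrite -subr_eq0 -coeffB; apply: contraNT u; exact: h.
apply/eqP; apply: contraTT u => /nf_supp/andP[] //.
Qed.

Lemma nf_restr x : restr (fun m => ~~ U2 (msup m)) (nf x) = nf x.
Proof. by apply: restr_id => m /nf_supp/andP[]. Qed.

Lemma nf_scale f x : nf (f *: x) = restr (fun m => ~~ U2 (msup m)) (f * nf x).
Proof.
by apply: nfE; rewrite ni_valZ nf_val; apply: quot_piZ.
Qed.

Lemma nfD x y : nf (x + y) = nf x + nf y.
Proof.
rewrite -(nf_restr x) -(nf_restr y) -restrD; apply: nfE.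
by rewrite ni_valD !nf_val; apply/esym/quot_piD.
Qed.

Lemma nf0 : nf 0 = 0.
Proof. by apply: (addrI (nf 0)); rewrite -nfD !addr0. Qed.

Lemma nf_sum (J : Type) (s : seq J) (F : J -> N) :
  nf (\sum_(j <- s) F j) = \sum_(j <- s) nf (F j).
Proof. exact: (big_morph _ nfD nf0). Qed.

Lemma nf_kscale c x : nf (kscale c x) = c%:MP * nf x.
Proof. by rewrite nf_scale restrCM nf_restr. Qed.

Lemma nf_inj : injective nf.
Proof. by move=> x y e; apply: ni_val_inj; rewrite !nf_val e. Qed.

Lemma nf_surj f : (forall m, coeff m f != 0 -> V (msup m)) -> exists x, nf x = f.
Proof.
move=> h; have [|x xf] := @ni_mk _ _ (Sgr k I) W1 W2 (f : Sgr k I).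
  by apply/(h1 f) => m /h/andP[].
by exists x; rewrite (nfE xf); apply: restr_id => m /h/andP[].
Qed.

Lemma nf_piece b x : piece b x <-> poly_piece b (nf x).
Proof.
split.
  move=> /ni_pieceE[m]; rewrite /= subr0 => /poly_pieceE mb /(@nfE _ (m : S)) ->.
  by apply/poly_pieceE => m' /coeff_restr_neq0[_ /mb].
by move=> h; apply/ni_pieceE; exists (nf x : Sgr k I); [rewrite /= subr0 | apply: nf_val].
Qed.

Lemma nf_homog b x : piece b x -> x = 0 \/
  exists m c, [/\ degm m = b, c != 0, V (msup m) & nf x = << c *g m >>].
Proof.
move=> /nf_piece xb; case: (eqVneq (nf x) 0) => [x0|x0].
  by left; apply: nf_inj; rewrite x0 nf0.
right; have [m [c [mb c0 e]]] := poly_piece_homog xb x0.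
exists m, c; split=> //; apply: (@nf_supp x).
by rewrite e coeffU eqxx.
Qed.

Lemma nf_monomial c m : V (msup m) -> exists x, nf x = << c *g m >>.
Proof.
move=> mV; apply: nf_surj => m'; rewrite coeffU.
by case: (m =P m') => [<-|]; rewrite ?eqxx.
Qed.

Lemma nf_scaleX i x m :
  coeff (mmul (ucm i) m) (nf (X_ k i *: x)) =
  if U2 (i |: msup m) then 0 else coeff m (nf x).
Proof.
rewrite nf_scale coeff_restr msupM msup_ucm if_neg; case: ifP => // _.
exact: coeff_monoM.
Qed.

Lemma scaleX_monomial i c m x :
  nf x = << c *g m >> -> ~~ U2 (i |: msup m) ->
  nf (X_ k i *: x) = << c *g mmul (ucm i) m >>.
Proof.
move=> e u; rewrite nf_scale e [_ * _]mulUU mul1r; apply: restr_id => m'.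
rewrite coeffU; case: (mmul (ucm i) m =P m') => [<- _|]; last by rewrite eqxx.
by rewrite msupM msup_ucm.
Qed.

Lemma ni_multigraded : multigraded N.
Proof.
split.
- move=> b; split; first by apply/nf_piece; rewrite nf0; apply: poly_piece0.
    move=> x y /nf_piece xb /nf_piece yb; apply/nf_piece.
    by rewrite nfD; apply: poly_pieceD.
  move=> c x /nf_piece xb; apply/nf_piece; rewrite nf_kscale -[b]add0r.
  by apply: poly_pieceM => //; apply: poly_pieceC.
- move=> a b f x fa /nf_piece xb; apply/nf_piece; rewrite nf_scale.
  have /poly_pieceE h := poly_pieceM fa xb.
  by apply/poly_pieceE => m /coeff_restr_neq0[_ /h].
- move=> x; have [s us e] := sum_hc (nf x).
  have /choice[h hP] : forall b, exists y : N, nf y = hc b (nf x).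
    by move=> b; apply: nf_surj => m /coeff_restr_neq0[_ /nf_supp].
  exists s, h; split=> [b|].
    by apply/nf_piece; rewrite hP; apply: hc_piece.
  apply: nf_inj; rewrite nf_sum {1}e; apply: eq_bigr => b _.
  by rewrite hP.
- move=> s h us hp h0 b bs; apply: nf_inj; rewrite nf0; apply/coeffP => m.
  rewrite coeff0; apply/eqP/negPn/negP => mb.
  have bE c : coeff m (nf (h c)) != 0 -> degm m = c.
    by move: m {mb}; apply/poly_pieceE/nf_piece.
  have := congr1 (coeff m) (congr1 nf h0).
  rewrite nf_sum nf0 coeff0 coeff_sum (bigD1_seq b) //= big1 ?addr0.
    by move/eqP; apply/negP.
  move=> c cb; apply/eqP/negPn/negP => /bE ec.
  by rewrite -(bE _ mb) ec eqxx in cb.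
Qed.

Lemma ni_finitely_generated : exists (r : nat) (g : 'I_r -> N),
  forall x, exists a : 'I_r -> S, x = \sum_j a j *: g j.
Proof.
(* One generator for each support; supports outside [V] receive the default 0. *)
have /choice[g gP] : forall j : 'I_#|{set I}|, exists y : N,
    V (enum_val j) -> nf y = mono k (mset (enum_val j)).
  move=> j; case: (boolP (V (enum_val j))) => [v|_]; last by exists 0.
  have [|y yP] := @nf_monomial 1 (mset (enum_val j)); first by rewrite msup_mset.
  by exists y.
exists _, g => x; have [_ _ dec _] := ni_multigraded.
have [s [h [hp ->]]] := dec x.
elim/big_ind: _ => [|y z [a ->] [a' ->]|b _].
- by exists (fun=> 0); rewrite big1 // => j _; rewrite scale0r.
- exists (fun j => a j + a' j); rewrite -big_split; apply: eq_bigr => j _.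
  by rewrite scalerDl.
case: (nf_homog (hp b)) => [->|[m [c [mb c0 mV e]]]].
  by exists (fun=> 0); rewrite big1 // => j _; rewrite scale0r.
have [m' em] := mset_div (subxx (msup m)).
pose j0 := enum_rank (msup m).
exists (fun j => if j == j0 then << c *g m' >> else 0).
rewrite (bigD1 j0) //= eqxx big1 ?addr0 => [|j /negbTE ->]; last by rewrite scale0r.
apply: nf_inj; rewrite nf_scale gP ?enum_rankK // [_ * _]mulUU mulr1 mulmC -em e.
apply/esym/restr_id => m2; rewrite coeffU.
by case: (m =P m2) => [<-|]; [case/andP: mV | rewrite eqxx].
Qed.

(** Where [b i] is at least 1, the variable [i] already divides the monomial, so multiplication by
    it leaves the support unchanged, and with it membership in the basis. *)
Lemma ni_squarefree : squarefree N.
Proof.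
split; [exact: ni_multigraded | | exact: ni_finitely_generated |].
  move=> b x /nf_homog[-> //|[m [c [<- _ _ _]]]] [i].
  by rewrite ffunE.
move=> b i bi; split=> [x xb e|x' x'b].
  case: (nf_homog xb) => // -[m [c [mb c0 mV ex]]].
  have mi : i |: msup m = msup m.
    apply/setUidPr; rewrite sub1set inE; apply/eqP => m0.
    by move: bi; rewrite -mb ffunE m0.
  have := nf_scaleX i x m; rewrite e nf0 coeff0 mi ex coeffU eqxx.
  case/andP: mV => _ /negbTE -> c00.
  by rewrite -c00 eqxx in c0.
case: (nf_homog x'b) => [->|[m' [c [mb c0 mV ex]]]].
  by exists 0; [apply/nf_piece; rewrite nf0; apply: poly_piece0 | rewrite scaler0].
have m'i : m' i != 0%N.
  have /ffunP/(_ i) := mb; rewrite !ffunE eqxx => e; apply/eqP => m0.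
  by move: bi e; rewrite m0; case: (b i) => // -[].
have [|m em] := @mset_div _ [set i] m'; first by rewrite sub1set inE.
rewrite /mset big_set1 in em.
have em' : degm m = b.
  by apply: (addrI (unit_deg i)); rewrite -degm_ucm -degmM -em mb addrC degm_ucm.
have mi : i |: msup m = msup m.
  apply/setUidPr; rewrite sub1set inE; apply/eqP => m0.
  by move: bi; rewrite -em' ffunE m0.
have mV' : V (msup m) by move: mV; rewrite em msupM msup_ucm mi.
have [x xP] := nf_monomial c mV'; exists x.
  apply/nf_piece/poly_pieceE => m2; rewrite xP coeffU.
  by case: (m =P m2) => [<-|]; rewrite ?eqxx.
apply: nf_inj; apply: etrans ex _; rewrite em; symmetry.
by apply: scaleX_monomial xP _; rewrite mi; case/andP: mV'.
Qed.

End NormalForm.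

(** * The duality pairing of complementary supports *)

Section DualPair.
Variables (k : fieldType) (I : finType).
Local Notation S := (polyring k I).
Variables (W1 W2 W1' W2' : ideal k I) (U1 U2 U1' U2' : pred {set I}).
Hypotheses (h1 : sqf W1 U1) (h2 : sqf W2 U2) (h1' : sqf W1' U1') (h2' : sqf W2' U2').
Hypothesis UE : forall A, U1' A && ~~ U2' A = U1 (~: A) && ~~ U2 (~: A).
Local Notation N := (natural_image (M := Sgr k I) W1 W2).
Local Notation N' := (natural_image (M := Sgr k I) W1' W2').
Local Notation nf' := (nf h1' h2').
Local Notation nf := (nf h1 h2).
Implicit Types (A : {set I}) (b : degree I).

Lemma zero_one_mset A : zero_one (degm (mset A)).
Proof. by move=> i; rewrite ffunE msetE; case: (i \in A); [right | left]. Qed.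

Lemma zero_oneP b : zero_one b -> exists A, b = degm (mset A).
Proof.
move=> hb; exists [set i | b i == 1]; apply/ffunP => i.
by rewrite ffunE msetE inE; case: (hb i) => ->.
Qed.

Lemma degm_msetC A : ones I - degm (mset A) = degm (mset (~: A)).
Proof. by apply/ffunP => i; rewrite !ffunE !msetE inE; case: (i \in A). Qed.

Lemma mset_inj : injective (@mset I).
Proof. by move=> A B e; rewrite -(msup_mset A) e msup_mset. Qed.

Lemma degm_msetU1 A i : i \notin A -> degm (mset A) + unit_deg i = degm (mset (i |: A)).
Proof. by move=> iA; rewrite -mset_setU1 // degmM degm_ucm addrC. Qed.

(* At b = degm (mset A) only the summand at A occurs; no other b matters. *)
Definition pairing b (y : N') (m : N) : k :=
  \sum_(A : {set I} | degm (mset A) == b) coeff (mset A) (nf' y) * coeff (mset (~: A)) (nf m).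

Lemma pairingE A y m :
  pairing (degm (mset A)) y m = coeff (mset A) (nf' y) * coeff (mset (~: A)) (nf m).
Proof.
rewrite /pairing (big_pred1 A) // => B.
by rewrite (inj_eq (@degm_inj _)) (inj_eq mset_inj).
Qed.

Lemma nf_set_homog A (m : N) : piece (degm (mset A)) m ->
  nf m = << coeff (mset A) (nf m) *g mset A >>.
Proof.
case/(nf_homog h1 h2) => [->|[m0 [c [/degm_inj -> _ _ ->]]]].
  by rewrite nf0 coeff0; apply/coeffP=> m'; rewrite coeffU coeff0 if_same.
by rewrite coeffU eqxx.
Qed.

Lemma nf_set_monomial A : U1 A && ~~ U2 A ->
  exists m : N, piece (degm (mset A)) m /\ nf m = mono k (mset A).
Proof.
move=> v; have [|m mE] := @nf_monomial _ _ _ _ _ _ h1 h2 1 (mset A).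
  by rewrite msup_mset.
exists m; split=> //; apply/(nf_piece h1 h2); rewrite mE; exact: poly_piece_mono.
Qed.

Lemma nf_set_kscale A (m m0 : N) : piece (degm (mset A)) m ->
  nf m0 = mono k (mset A) -> m = kscale (coeff (mset A) (nf m)) m0.
Proof.
move=> /nf_set_homog e e0; apply: (@nf_inj _ _ _ _ _ _ h1 h2).
rewrite nf_kscale e0 [RHS]mulUU mulr1 mul1m; exact: e.
Qed.

Lemma functional0 (M : gmodule k I) b (phi : M -> k) :
  multigraded M -> functional b phi -> phi 0 = 0.
Proof.
move=> [h _ _ _] f; have [p0 _ _] := h b; have := f 1 0 0 p0 p0.
rewrite /kscale scaler0 addr0 mul1r => e.
by apply: (addrI (phi 0)); rewrite -e addr0.
Qed.

Lemma natural_image_dual : alexander_dual N N'.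
Proof.
split; [exact: (ni_squarefree h1 h2) | exact: (ni_squarefree h1' h2') |].
exists pairing; split.
- move=> b /zero_oneP[A ->] y _ c m m' _ _.
  by rewrite !pairingE nfD nf_kscale coeffD coeffCM mulrDr mulrCA.
- move=> b /zero_oneP[A ->] c y y' _ _ m _.
  by rewrite !pairingE nfD nf_kscale coeffD coeffCM mulrDl mulrA.
- move=> b /zero_oneP[A ->] y /(nf_homog h1' h2')[-> //|[m0 [c [/degm_inj -> c0 v e]]]].
  rewrite msup_mset UE in v; have [m [mA mE]] := nf_set_monomial v.
  rewrite degm_msetC => /(_ m mA); rewrite pairingE e mE coeffU eqxx.
  by rewrite coeff_mono eqxx mulr1 => c00; rewrite c00 eqxx in c0.
- move=> b /zero_oneP[A ->] phi; rewrite degm_msetC => phiF.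
  case: (boolP (U1 (~: A) && ~~ U2 (~: A))) => v.
    have [m0 [m0A m0E]] := nf_set_monomial v.
    have [|y yE] := @nf_monomial _ _ _ _ _ _ h1' h2' (phi m0) (mset A).
      by rewrite msup_mset UE.
    exists y => [|m mA].
      apply/(nf_piece h1' h2')/poly_pieceE => m'; rewrite yE coeffU.
      by case: (mset A =P m') => [<-|]; rewrite ?eqxx.
    rewrite pairingE yE coeffU eqxx {2}(nf_set_kscale mA m0E).
    have [h _ _ _] := ni_multigraded h1 h2; have [p0 _ _] := h (degm (mset (~: A))).
    have := phiF (coeff (mset (~: A)) (nf m)) m0 0 m0A p0.
    rewrite addr0 => ->; rewrite (functional0 (ni_multigraded h1 h2) phiF).
    by rewrite addr0 mulrC.
  exists 0; first by apply/(nf_piece h1' h2'); rewrite nf0; apply: poly_piece0.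
  move=> m /(nf_homog h1 h2)[->|[m1 [c [/degm_inj -> _ v' _]]]].
    by rewrite pairingE nf0 coeff0 mul0r (functional0 (ni_multigraded h1 h2) phiF).
  by rewrite msup_mset (negbTE v) in v'.
- move=> b i /zero_oneP[A ->]; rewrite ffunE msetE => iA y m yA.
  have {}iA : i \notin A by move: iA; case: (i \in A).
  have iC : i \notin ~: (i |: A) by rewrite !inE eqxx.
  have CA : ~: A = i |: ~: (i |: A).
    by apply/setP=> j; rewrite !inE; case: (j =P i) => // ->.
  rewrite degm_msetU1 // -addrA -opprD degm_msetU1 // degm_msetC => mA.
  rewrite !pairingE -(mset_setU1 iA) nf_scaleX msup_mset.
  rewrite CA -(mset_setU1 iC) nf_scaleX msup_mset -CA.
  case: (eqVneq (coeff (mset A) (nf' y)) 0) => [->|yn0].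
    by rewrite if_same !mul0r.
  case: (eqVneq (coeff (mset (~: (i |: A))) (nf m)) 0) => [->|mn0].
    by rewrite if_same !mulr0.
  (* When both coefficients are nonzero neither product is truncated: [UE] at [A] excludes
     [U2 (~: A)], and [UE] at [i |: A] excludes [U2' (i |: A)]. *)
  have := nf_supp yn0; rewrite msup_mset UE => /andP[_ /negbTE ->].
  by have := nf_supp mn0; rewrite msup_mset -UE => /andP[_ /negbTE ->].
Qed.

(** * Uniqueness of the Alexander dual *)

Section Uniqueness.
Variable D : gmodule k I.
Hypothesis ND : alexander_dual N D.

Lemma kscaleDl (M : lmodType S) c c' (x : M) :
  kscale (c + c') x = kscale c x + kscale c' x.
Proof. by rewrite /kscale monalgUD; apply: scalerDl. Qed.

Lemma kscaleA (M : lmodType S) c c' (x : M) :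
  kscale c (kscale c' x) = kscale (c * c') x.
Proof.
rewrite /kscale; apply: etrans (scalerA _ _ _) _; congr (_ *: _).
by apply: etrans (mulUU _ _ _ _) _; rewrite mul1m.
Qed.

Lemma kscale0l (M : lmodType S) (x : M) : kscale 0 x = 0.
Proof. by rewrite /kscale monalgU0; apply: scale0r. Qed.

Lemma kscale1 (M : lmodType S) (x : M) : kscale 1 x = x.
Proof. exact: scale1r. Qed.

Lemma kscaleN1 (M : lmodType S) (x : M) : kscale (-1) x = - x.
Proof.
apply: (addrI x); rewrite subrr -{1}(kscale1 x) -kscaleDl subrr; exact: kscale0l.
Qed.

Lemma kscale_eq0 (M : lmodType S) c (x : M) : kscale c x = 0 -> c = 0 \/ x = 0.
Proof.
move=> e; case: (eqVneq c 0) => [->|c0]; [by left | right].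
by rewrite -(kscale1 x) -(mulVf c0) -kscaleA e /kscale scaler0.
Qed.

Let D_mg : multigraded D. Proof. by case: ND => _ []. Qed.

Let D0 b : piece (g := D) b 0.
Proof. by have [h _ _ _] := D_mg; have [] := h b. Qed.
Let DD b (x y : D) : piece b x -> piece b y -> piece b (x + y).
Proof. by have [h _ _ _] := D_mg; have [_ p _] := h b; apply: p. Qed.
Let Dk b c (x : D) : piece b x -> piece b (kscale c x).
Proof. by have [h _ _ _] := D_mg; have [_ _] := h b; apply. Qed.
Let DM a b f (x : D) : poly_piece a f -> piece b x -> piece (a + b) (f *: x).
Proof. by have [_ h _ _] := D_mg; apply: h. Qed.
Let Dmono m b (x : D) : piece b x -> piece (b + degm m) (mono k m *: x).
Proof. by move=> xb; rewrite addrC; apply: DM => //; apply: poly_piece_mono. Qed.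

Lemma mon_ind (Q : cmonom I -> Prop) :
  Q mone -> (forall i m, Q m -> Q (mmul (ucm i) m)) -> forall m, Q m.
Proof.
move=> Q1 QM m; move: {2}(mdeg m) (erefl (mdeg m)) => n.
elim: n m => [|n IH] m e; first by rewrite (mdeg_eq0I e).
have [i mi] : exists i, i \in msup m.
  apply: contra_eqP e => /forallNP h.
  suff -> : m = mone by rewrite mdeg1.
  by apply: cmonom_eqP => i; rewrite cm1; have /negP := h i; rewrite inE negbK => /eqP.
have [|m' em] := @mset_div _ [set i] m; first by rewrite sub1set.
rewrite /mset big_set1 in em; rewrite em; apply/QM/IH.
by move: e; rewrite em mdegM mdegU => -[].
Qed.

(** Iterates the squarefree condition over the variables of [m]; degrees only grow on the way, so
    the bound on [b] persists. *)
Lemma mono_inj m b (x : D) : (forall i, i \in msup m -> 1 <= b i) ->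
  piece b x -> mono k m *: x = 0 -> x = 0.
Proof.
have [_ [_ _ _ DX] _] := ND.
elim/mon_ind: m b x => [|i m IH] b x hb xb; first by rewrite mono1 scale1r.
rewrite mulmC monoM -scalerA => e.
have bi : 1 <= b i by apply: hb; rewrite msupM msup_ucm !inE eqxx.
have [inj _] := DX b i bi; apply: (inj _ xb).
apply: (IH (b + unit_deg i)) e => [j jm|].
  rewrite ffunE; apply: (Order.POrderTheory.le_trans (hb j _)).
    by rewrite msupM inE jm orbT.
  by rewrite Num.Theory.lerDl ffunE.
by rewrite -degm_ucm; apply: Dmono.
Qed.

Lemma mono_surj m b (x' : D) : (forall i, i \in msup m -> 1 <= b i) ->
  piece (b + degm m) x' -> exists2 x : D, piece b x & x' = mono k m *: x.
Proof.
have [_ [_ _ _ DX] _] := ND.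
elim/mon_ind: m b x' => [|i m IH] b x' hb x'b.
  exists x'; last by rewrite mono1 scale1r.
  suff <- : b + degm mone = b by [].
  by apply/ffunP=> i; rewrite !ffunE cm1 addr0.
have bi : 1 <= b i by apply: hb; rewrite msupM msup_ucm !inE eqxx.
have [||x1 x1b ->] := IH (b + unit_deg i) x'.
- move=> j jm; rewrite ffunE; apply: (Order.POrderTheory.le_trans (hb j _)).
    by rewrite msupM inE jm orbT.
  by rewrite Num.Theory.lerDl ffunE.
- by rewrite -addrA -degm_ucm -degmM.
have [_ sur] := DX b i bi; have [x xb ->] := sur _ x1b.
by exists x => //; rewrite mulmC monoM; apply: scalerA.
Qed.

(** [y A] is chosen to represent the functional that reads the coefficient at the complementary set.
    This normalises all the scalars at once, so multiplication by a variable sends [y A] to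
    [y (i |: A)] exactly. *)
Lemma dual_basis : exists y : {set I} -> D,
  [/\ forall A, piece (degm (mset A)) (y A),
      forall A, U1' A && ~~ U2' A -> y A <> 0,
      forall A, ~~ (U1' A && ~~ U2' A) ->
        forall z : D, piece (degm (mset A)) z -> z = 0,
      forall A (z : D), piece (degm (mset A)) z -> exists c, z = kscale c (y A)
    & forall A i, i \notin A -> U1' A -> X_ k i *: y A = y (i |: A)].
Proof.
have [_ _ [th [t1 t2 t3 t4 t5]]] := ND.
have N_mg := ni_multigraded h1 h2.
have /choice[y yP] : forall A, exists y : D, piece (degm (mset A)) y /\
    forall m : N, piece (ones I - degm (mset A)) m ->
    th (degm (mset A)) y m = coeff (mset (~: A)) (nf m).
  move=> A; have [|y yA yE] := t4 _ (zero_one_mset A) (fun m => coeff (mset (~: A)) (nf m)).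
    by move=> c m m' _ _; rewrite nfD nf_kscale coeffD coeffCM.
  by exists y.
have zP A : ~~ (U1' A && ~~ U2' A) -> forall m : N,
    piece (ones I - degm (mset A)) m -> m = 0.
  rewrite UE => v m; rewrite degm_msetC => /(nf_homog h1 h2)[//|[m1 [c [/degm_inj -> _ v' _]]]].
  by rewrite msup_mset (negbTE v) in v'.
have uniq A (z z' : D) : piece (degm (mset A)) z -> piece (degm (mset A)) z' ->
    (forall m : N, piece (ones I - degm (mset A)) m ->
      th (degm (mset A)) z m = th (degm (mset A)) z' m) -> z = z'.
  move=> zA z'A e; apply/eqP; rewrite -subr_eq0 -kscaleN1 addrC; apply/eqP.
  apply: (t3 _ (zero_one_mset A)); first exact/DD/zA/Dk.
  move=> m mA; rewrite t2 ?e //; last exact: zero_one_mset.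
  by rewrite mulN1r addNr.
have th0 A m : piece (ones I - degm (mset A)) m -> th (degm (mset A)) 0 m = 0.
  move=> mA; have := t2 _ (zero_one_mset A) 1 0 0 (D0 _) (D0 _) m mA.
  rewrite /kscale scaler0 addr0 mul1r => e.
  by apply: (addrI (th (degm (mset A)) 0 m)); rewrite -e addr0.
exists y; split.
- by move=> A; have [] := yP A.
- move=> A v yA0; have := v; rewrite UE => /nf_set_monomial[m0 [m0A m0E]].
  have [_ /(_ m0)] := yP A; rewrite degm_msetC => /(_ m0A).
  rewrite yA0 th0 ?degm_msetC // m0E coeff_mono eqxx => /esym/eqP.
  by rewrite oner_eq0.
- move=> A v z zA; apply: (uniq _ _ _ zA (D0 _)) => m mA.
  rewrite th0 // (zP _ v _ mA); exact: (functional0 N_mg (t1 _ (zero_one_mset A) _ zA)).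
- move=> A z zA; case: (boolP (U1' A && ~~ U2' A)) => v; last first.
    exists 0; rewrite kscale0l; apply: (uniq _ _ _ zA (D0 _)) => m mA.
    rewrite th0 // (zP _ v _ mA); exact: (functional0 N_mg (t1 _ (zero_one_mset A) _ zA)).
  have := v; rewrite UE => /nf_set_monomial[m0 [m0A m0E]].
  have [yA yE] := yP A; exists (th (degm (mset A)) z m0).
  apply: (uniq _ _ _ zA (Dk _ yA)) => m mA; have mA' := mA; rewrite degm_msetC in mA'.
  have F0 := functional0 N_mg (t1 _ (zero_one_mset A) _ zA).
  have := t2 _ (zero_one_mset A) (th (degm (mset A)) z m0) (y A) 0 yA (D0 _) m mA.
  rewrite addr0 => ->; rewrite th0 // addr0 yE //.
  have [h _ _ _] := N_mg; have [p0 _ _] := h (ones I - degm (mset A)).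
  rewrite {1}(nf_set_kscale mA' m0E) -[kscale _ m0]addr0.
  rewrite (t1 _ (zero_one_mset A) _ zA) ?F0 ?addr0 1?mulrC //.
  by rewrite degm_msetC.
- move=> A i iA v1; have [yA yE] := yP A; have [yiA yiE] := yP (i |: A).
  have Xy : piece (degm (mset (i |: A))) (X_ k i *: y A).
    by rewrite -degm_msetU1 // -degm_ucm; apply: Dmono.
  apply: (uniq _ _ _ Xy yiA) => m mA; rewrite yiE //.
  have mA' := mA; rewrite -degm_msetU1 // opprD addrA in mA'.
  have bi : degm (mset A) i = 0 by rewrite ffunE msetE (negbTE iA).
  have := t5 _ i (zero_one_mset A) bi _ _ yA mA'.
  rewrite degm_msetU1 // => ->.
  have iC : i \notin ~: (i |: A) by rewrite !inE eqxx.
  have CA : ~: A = i |: ~: (i |: A).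
    by apply/setP=> j; rewrite !inE; case: (j =P i) => // ->.
  rewrite yE; last first.
    have [_ NM _ _] := N_mg.
    have := NM _ _ _ _ (@poly_piece_mono k I (ucm i)) mA'.
    by rewrite degm_ucm addrCA subrr addr0.
  rewrite CA -(mset_setU1 iC) nf_scaleX msup_mset -CA; case: ifP => // u2.
  (* Here multiplication by [i] is truncated on the original module. With [U1' A], [UE] then forces
     [U2' A], hence [U2' (i |: A)], so the coefficient on the other side must vanish too. *)
  case: (eqVneq (coeff (mset (~: (i |: A))) (nf m)) 0) => [-> //|/nf_supp].
  rewrite msup_mset -UE => /andP[_ u2i].
  case/negP: u2i; have := UE A; rewrite v1 u2 andbF /=.
  by move/negbFE => u; apply: sqf_up h2' _ u; apply: subsetUr.
Qed.

Section LinearExtension.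
Variable y : {set I} -> D.
Hypothesis y_piece : forall A, piece (degm (mset A)) (y A).
Hypothesis y_neq0 : forall A, U1' A && ~~ U2' A -> y A <> 0.
Hypothesis y_zero : forall A, ~~ (U1' A && ~~ U2' A) ->
  forall z : D, piece (degm (mset A)) z -> z = 0.
Hypothesis y_gen : forall A (z : D), piece (degm (mset A)) z ->
  exists c, z = kscale c (y A).
Hypothesis y_X : forall A i, i \notin A -> U1' A -> X_ k i *: y A = y (i |: A).

Let quo (m : cmonom I) : cmonom I := divcm m (mset (msup m)).

Let quoE m : m = mmul (mset (msup m)) (quo m).
Proof.
apply: cmonom_eqP => i; rewrite cmM divcmE msetE subnKC // inE.
by case: (m i).
Qed.

Let quo_uniq A m m' : msup m = A -> m = mmul (mset A) m' -> quo m = m'.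
Proof. by move=> <- e; apply: (@mmulI _ (mset (msup m))); rewrite -quoE. Qed.

(* By squarefreeness, D in degree m is D in degree supp m multiplied by m/supp m. *)
Let ym m : D := mono k (quo m) *: y (msup m).

Lemma ym_piece m : piece (degm m) (ym m).
Proof. by rewrite [X in degm X]quoE degmM; apply: Dmono. Qed.

(** The hypothesis matters: outside [U1'] the element [ym m] is 0, while [ym (mmul (ucm i) m)] may
    not be. *)
Lemma ym_X i m : U1' (msup m) -> X_ k i *: ym m = ym (mmul (ucm i) m).
Proof.
move=> u; have iE : msup (mmul (ucm i) m) = i |: msup m by rewrite msupM msup_ucm.
rewrite /ym iE; case: (boolP (i \in msup m)) => im.
  have e : i |: msup m = msup m by apply/setUidPr; rewrite sub1set.
  rewrite (@quo_uniq (msup m) (mmul (ucm i) m) (mmul (ucm i) (quo m))).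
  - by rewrite e monoM; apply: scalerA.
  - by rewrite iE e.
  - by rewrite mulmA (mulmC (mset _)) -mulmA -quoE.
rewrite (@quo_uniq (i |: msup m) (mmul (ucm i) m) (quo m)) //; last first.
  by rewrite -mset_setU1 // -mulmA -quoE.
rewrite -(y_X im u); apply: etrans (scalerA (X_ k i) _ _) _.
by rewrite mulrC; apply/esym/scalerA.
Qed.

Lemma ym_mono m' m : U1' (msup m) -> mono k m' *: ym m = ym (mmul m' m).
Proof.
move=> u; elim/mon_ind: m' => [|i m' IH]; first by rewrite mono1 scale1r mul1m.
rewrite -mulmA -ym_X; last first.
  by rewrite msupM; apply: sqf_up h1' _ u; apply: subsetUr.
by rewrite -IH monoM; apply/esym/scalerA.
Qed.

Lemma ym_eq0 m : ~~ (U1' (msup m) && ~~ U2' (msup m)) -> ym m = 0.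
Proof. by move=> u; rewrite /ym (y_zero u (y_piece _)) scaler0. Qed.

Lemma ym_neq0 m : U1' (msup m) && ~~ U2' (msup m) -> ym m <> 0.
Proof.
move=> v e; apply: (y_neq0 v); apply: mono_inj (y_piece _) e => i im.
rewrite ffunE msetE (_ : i \in msup m) //.
by rewrite [m]quoE msupM inE im orbT.
Qed.

Definition linear_ext (f : S) : D := \sum_(m <- msupp f) kscale (coeff m f) (ym m).

Lemma linear_extE (X : {fset cmonom I}) f : (msupp f `<=` X)%fset ->
  linear_ext f = \sum_(m <- X) kscale (coeff m f) (ym m).
Proof.
move=> fX; rewrite /linear_ext; apply: big_fset_incl => // m _.
by rewrite coeff_msupp negbK => /eqP ->; apply: kscale0l.
Qed.

Lemma linear_extD f g : linear_ext (f + g) = linear_ext f + linear_ext g.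
Proof.
rewrite (linear_extE (msuppD_le f g)) (linear_extE (fsubsetUl (msupp f) (msupp g))).
rewrite (linear_extE (fsubsetUr (msupp f) (msupp g))) -big_split.
by apply: eq_bigr => m _; rewrite coeffD kscaleDl.
Qed.

Lemma linear_ext0 : linear_ext 0 = 0.
Proof. by apply: (addrI (linear_ext 0)); rewrite -linear_extD !addr0. Qed.

Lemma linear_ext_sum (J : Type) (s : seq J) (F : J -> S) :
  linear_ext (\sum_(j <- s) F j) = \sum_(j <- s) linear_ext (F j).
Proof. exact: (big_morph _ linear_extD linear_ext0). Qed.

Lemma linear_extU c m : linear_ext << c *g m >> = kscale c (ym m).
Proof.
rewrite (linear_extE (msuppU_le (k := m) (x := c))) big_seq_fset1.
by rewrite coeffU eqxx.
Qed.

Lemma linear_ext_piece b f : poly_piece b f -> piece b (linear_ext f).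
Proof.
move/poly_pieceE=> h; rewrite /linear_ext big_seq.
elim/big_ind: _ => [|u v|m]; [exact: D0 | exact: DD |].
by rewrite coeff_msupp => /h <-; apply/Dk/ym_piece.
Qed.

(** For the same reason [linear_ext] respects multiplication by polynomials only on those supported
    in [U1']. *)
Lemma linear_extM f g : (forall m, coeff m g != 0 -> U1' (msup m)) ->
  linear_ext (f * g) = f *: linear_ext g.
Proof.
move=> gU; rewrite {1}[g]polyE mulr_sumr linear_ext_sum [in RHS]/linear_ext scaler_sumr.
rewrite big_seq [RHS]big_seq; apply: eq_bigr => m; rewrite coeff_msupp => /gU u.
move: (coeff m g) => c.
rewrite [f]polyE mulr_suml linear_ext_sum scaler_suml; apply: eq_bigr => m' _.
move: (coeff m' f) => c'.
rewrite mulUU linear_extU -(ym_mono m' u) /kscale [X in _ = X *: _]monoZ.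
apply: etrans (scalerA _ _ _) _; apply: etrans _ (esym (scalerA _ _ _)).
have -> : (c' * c)%:MP = c'%:MP * c%:MP :> S.
  by symmetry; apply: etrans (mulUU _ _ _ _) _; rewrite mul1m.
exact: (congr1 (fun z : S => z *: ym m) (mulrAC _ _ _)).
Qed.

Lemma linear_ext_eq0 f : (forall m, coeff m f != 0 -> U2' (msup m)) -> linear_ext f = 0.
Proof.
move=> h; rewrite /linear_ext big_seq big1 // => m; rewrite coeff_msupp => /h u.
by rewrite ym_eq0 ?u ?andbF // /kscale scaler0.
Qed.

Lemma linear_ext_homog_eq0 b f : poly_piece b f ->
  (forall m, coeff m f != 0 -> U1' (msup m) && ~~ U2' (msup m)) ->
  linear_ext f = 0 -> f = 0.
Proof.
move=> fb fV; case: (eqVneq f 0) => // f0.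
have [m [c [mb c0 e]]] := poly_piece_homog fb f0.
rewrite e linear_extU => /kscale_eq0[-> |]; first by rewrite monalgU0.
by move/ym_neq0; case; apply: fV; rewrite e coeffU eqxx.
Qed.

Definition dual_map (x : N') : D := linear_ext (nf' x).

Lemma dual_map_linear : linear dual_map.
Proof.
move=> f x x'; rewrite /dual_map nfD nf_scale linear_extD; congr (_ + _).
rewrite -linear_extM; last by move=> m /nf_supp/andP[].
(* Truncation drops only monomials in [U2'], which [linear_ext] sends to 0. *)
rewrite -[in RHS](subrK (restr (fun m => ~~ U2' (msup m)) (f * nf' x)) (f * nf' x)).
rewrite linear_extD [X in X + _]linear_ext_eq0 ?add0r // => m.
by rewrite coeffB coeff_restr; case: ifP => [_|/negbFE //]; rewrite subrr eqxx.
Qed.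

Lemma dual_map_eq0 x : dual_map x = 0 -> x = 0.
Proof.
move=> x0; apply: (@nf_inj _ _ _ _ _ _ h1' h2'); rewrite nf0.
have [s us e] := sum_hc (nf' x); rewrite e.
have [_ _ _ uniqD] := D_mg.
have z := uniqD s (fun b => linear_ext (hc b (nf' x))) us.
rewrite big_seq big1 // => b bs.
apply: (linear_ext_homog_eq0 (@hc_piece _ _ b (nf' x))).
  by move=> m /coeff_restr_neq0[_ /nf_supp].
apply: z => // [b'|]; first exact/linear_ext_piece/hc_piece.
by rewrite -linear_ext_sum -e.
Qed.

Lemma dual_map_piece b x : piece b x <-> piece b (dual_map x).
Proof.
split=> [/(nf_piece h1' h2')|xb]; first exact: linear_ext_piece.
apply/(nf_piece h1' h2').
have [s us e] := sum_hc (nf' x).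
have [_ _ _ uniqD] := D_mg.
(* Moving [dual_map x] into the component of degree [b] gives homogeneous elements with sum 0.
   Directness of the grading of [D] then kills every other component. The default 0 covers the case
   where [b] is not in [s]. *)
pose h c := if c == b then (if b \in s then linear_ext (hc b (nf' x)) else 0) - dual_map x
  else linear_ext (hc c (nf' x)).
have hp c : piece c (h c).
  rewrite /h; case: (c =P b) => [->|_]; last exact/linear_ext_piece/hc_piece.
  apply: DD; last by rewrite -kscaleN1; apply: Dk.
  by case: ifP => _; [exact/linear_ext_piece/hc_piece | exact: D0].
have hbs : \sum_(c <- s | c != b) h c = \sum_(c <- s | c != b) linear_ext (hc c (nf' x)).
  by apply: eq_bigr => c /negbTE cb; rewrite /h cb.
have hsum : \sum_(c <- b :: [seq c <- s | c != b]) h c = 0.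
  rewrite big_cons big_filter hbs {1}/h eqxx addrAC; apply/eqP; rewrite subr_eq0.
  rewrite /dual_map [X in _ == linear_ext X]e linear_ext_sum; apply/eqP.
  case: ifP => bs; first by rewrite [RHS](bigD1_seq b).
  rewrite add0r big_seq_cond [RHS]big_seq_cond; apply: eq_bigl => c.
  by case: (c =P b) => [->|]; rewrite ?bs ?andbT.
have uq : uniq (b :: [seq c <- s | c != b]).
  by rewrite /= filter_uniq // mem_filter eqxx.
have z := uniqD _ h uq hp hsum.
rewrite e big_seq; elim/big_ind: _ => [|f g|c cs].
- exact: poly_piece0.
- exact: poly_pieceD.
case: (eqVneq c b) => [->|cb]; first exact: hc_piece.
rewrite (linear_ext_homog_eq0 (@hc_piece _ _ c (nf' x))); first exact: poly_piece0.
  by move=> m /coeff_restr_neq0[_ /nf_supp].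
have := z c; rewrite /h (negbTE cb); apply.
by rewrite inE mem_filter cb cs orbT.
Qed.

Lemma dual_map_surj z : exists x, dual_map x = z.
Proof.
have [_ _ dec _] := D_mg; have [s [h [hp ->]]] := dec z.
elim/big_ind: _ => [|_ _ [x <-] [x' <-]|b _].
- by exists 0; rewrite /dual_map nf0 linear_ext0.
- by exists (x + x'); rewrite /dual_map nfD linear_extD.
move: (h b) (hp b) => {}z zb; have [_ [_ Dneg _ _] _] := ND.
have [[i bi]|nneg] := EM (exists i, b i < 0).
  exists 0; rewrite (Dneg _ _ zb); last by exists i.
  by rewrite /dual_map nf0 linear_ext0.
have [|m em] := @degm_surj _ b.
  by move=> i; rewrite Order.TotalTheory.leNgt; apply/negP => bi; apply: nneg; exists i.
rewrite -em [X in degm X]quoE degmM in zb.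
have [|z' z'A ->] := mono_surj _ zb.
  move=> i im; rewrite ffunE msetE (_ : i \in msup m) //.
  by rewrite [m]quoE msupM inE im orbT.
have [c ->] := y_gen z'A; case: (boolP (U1' (msup m) && ~~ U2' (msup m))) => v.
  have [x xE] := nf_monomial h1' h2' c v; exists x.
  rewrite /dual_map xE linear_extU /kscale /ym.
  by apply: etrans (scalerA _ _ _) _; rewrite mulrC; apply/esym/scalerA.
exists 0; rewrite /dual_map nf0 linear_ext0 (y_zero v (y_piece _)).
have -> : kscale c 0 = 0 :> D by apply: scaler0.
by apply/esym/scaler0.
Qed.

Lemma dual_map_iso : graded_iso N' D.
Proof.
have inj : injective dual_map.
  move=> x x' e; apply/eqP; rewrite -subr_eq0; apply/eqP/dual_map_eq0.
  by rewrite -scaleN1r addrC dual_map_linear e scaleN1r addNr.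
have /choice[g gK] := dual_map_surj.
pose f : {linear N' -> D} :=
  HB.pack dual_map (GRing.isLinear.Build _ _ _ _ dual_map dual_map_linear).
exists f; split; last exact: dual_map_piece.
by exists g => // x; apply: inj; rewrite gK.
Qed.

End LinearExtension.

Lemma dual_unique : graded_iso D N'.
Proof.
have [y [y1 y2 y3 y4 y5]] := dual_basis.
exact: graded_iso_sym (dual_map_iso y1 y2 y3 y4 y5).
Qed.

End Uniqueness.
End DualPair.

(** * Invariance under graded isomorphism *)

Section Transport.
Variables (k : fieldType) (I : finType).
Local Notation S := (polyring k I).
Implicit Types (M N : gmodule k I).

Lemma linear_kscale M N (f : {linear M -> N}) c x : f (kscale c x) = kscale c (f x).
Proof. exact: linearZ. Qed.

Lemma squarefree_iso M N : graded_iso M N -> squarefree N -> squarefree M.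
Proof.
move=> [f [[g fK gK] fp]] [[N1 N2 N3 N4] Nneg [r [gen genP]] NX].
have finj : injective f := can_inj fK.
split.
- split.
  + move=> b; have [p0 pD pk] := N1 b; split=> [|x y xb yb|c x xb]; apply/fp.
    * by rewrite linear0.
    * by rewrite linearD; apply: pD; apply/fp.
    * by rewrite linear_kscale; apply/pk/fp.
  + by move=> a b s x sa xb; apply/fp; rewrite linearZ; apply: N2 => //; apply/fp.
  + move=> x; have [s [h [hp e]]] := N3 (f x); exists s, (g \o h); split=> [b|].
      by apply/fp; rewrite /= gK.
    apply: finj; rewrite linear_sum e; apply: eq_bigr => b _.
    by rewrite /= gK.
  + move=> s h us hp h0 b bs; apply: finj; rewrite linear0.
    apply: (N4 s (f \o h) us _ _ b bs) => [c|]; first exact/fp.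
    by rewrite -[RHS](linear0 f) -h0 linear_sum.
- move=> b x /fp xb neg; apply: finj; rewrite linear0; exact: Nneg xb neg.
- exists r, (g \o gen) => x; have [a e] := genP (f x); exists a.
  apply: finj; rewrite linear_sum e; apply: eq_bigr => j _.
  by rewrite linearZ /= gK.
- move=> b i bi; have [inj sur] := NX b i bi; split=> [x /fp xb e|x' /fp x'b].
    apply: finj; rewrite linear0; apply: inj xb _.
    by rewrite -linearZ /= e linear0.
  have [y yb e] := sur _ x'b; exists (g y); first by apply/fp; rewrite gK.
  by apply: finj; rewrite linearZ /= gK.
Qed.

Lemma alexander_dual_iso M M' N : graded_iso M M' -> alexander_dual M' N ->
  alexander_dual M N.
Proof.
move=> isof [sM sN [th [t1 t2 t3 t4 t5]]]; have sM' := squarefree_iso isof sM.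
have [f [[g fK gK] fp]] := isof; split=> //.
exists (fun b y x => th b y (f x)); split.
- move=> b hb y yb c x x' /fp xb /fp x'b.
  by rewrite linearD linear_kscale; apply: t1.
- by move=> b hb c y y' yb y'b x /fp; apply: t2.
- move=> b hb y yb h; apply: (t3 b) => // x xb.
  by rewrite -(gK x); apply: h; apply/fp; rewrite gK.
- move=> b hb phi phiF; have [|y yb e] := t4 b hb (phi \o g).
    move=> c x x' xb x'b.
    have gp z : piece (ones I - b) z -> piece (ones I - b) (g z).
      by move=> zb; apply/fp; rewrite gK.
    have -> : (phi \o g) (kscale c x + x') = phi (kscale c (g x) + g x').
      by congr phi; apply: (can_inj fK); rewrite linearD linear_kscale !gK.
    exact: phiF (gp _ xb) (gp _ x'b).
  exists y => // x xb; rewrite e ?[LHS]/= ?fK //.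
  by apply/fp.
- move=> b i hb bi y x yb /fp xb.
  by rewrite [X in _ = th _ _ X]linearZ; apply: t5.
Qed.

End Transport.

(** * The canonical module *)

Section LinkedIdeals.
Variables (k : fieldType) (I : finType).
Local Notation S := (polyring k I).
Local Notation restr := (@restr k I).
Implicit Types (A B : {set I}) (W K a : ideal k I) (U : pred {set I}).

Lemma sqf_exists U : (forall A B, A \subset B -> U A -> U B) ->
  exists W, sqf W U.
Proof.
move=> up; exists (Defs.span (V := Sgr k I)
  (fun f => exists2 A : {set I}, U A & f = set_mono k A)).
apply: (@sqf_span _ _ _ (fun A => U A)) => // B.
by split=> [uB|[A uA /up]]; [exists B | apply].
Qed.

Lemma sqf_graded W U : sqf W U -> graded_ideal W.
Proof. by move=> WU b f; apply: sqf_restr WU. Qed.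

Lemma set_mono_dvd A (f : S) : (forall m, coeff m f != 0 -> A \subset msup m) ->
  exists g, f = set_mono k A * g.
Proof.
move=> h; exists (\sum_(m <- msupp f) << coeff m f *g divcm m (mset A) >>).
rewrite {1}[f]polyE mulr_sumr big_seq [RHS]big_seq; apply: eq_bigr => m.
rewrite coeff_msupp => /h/subsetP mA.
have e : mmul (mset A) (divcm m (mset A)) = m.
  apply: cmonom_eqP => i; rewrite cmM divcmE msetE subnKC //.
  by case: (boolP (i \in A)) => [/mA|]; rewrite ?inE -?lt0n.
rewrite set_monoE; apply: etrans _ (esym (mulUU _ _ _ _)).
by rewrite mul1r e.
Qed.

(** The second isomorphism theorem: [a] is the intersection of [K] and [L], and K + L = B + L, so
    K/a = (K + L)/L = (B + L)/L. The relation used is congruence modulo [L]. *)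
Lemma natural_image_linked (K a B L : ideal k I) (UK Ua UB UL : pred {set I}) :
  sqf K UK -> sqf a Ua -> sqf B UB -> sqf L UL ->
  (forall A, UB A -> UK A) -> (forall A, UK A -> UB A || UL A) ->
  (forall A, Ua A = UK A && UL A) ->
  graded_iso (natural_image (M := Sgr k I) K a) (natural_image (M := Sgr k I) B L).
Proof.
move=> hK ha hB hL BK KBL aE.
have pr_Sgr : projector (M := Sgr k I) (fun b (f : S) => hc b f).
  split=> [b x y|b x|b x h]; first exact: hcB.
    by rewrite /= subr0; exact: hc_piece.
  by apply: hc_id; move: h; rewrite /= subr0.
apply: (@graded_iso_of_rel k I (Sgr k I) (Sgr k I) _ _ _ _
  (fun b (f : S) => hc b f) (fun b (f : S) => hc b f)
  (fun s s' => [/\ s \in K, s' \in B & s - s' \in L])) => //.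
- exact: sqf_graded ha.
- exact: sqf_graded hL.
- move=> b s s' [sK s'B ss']; split; [exact: (sqf_graded hK) | exact: (sqf_graded hB) |].
  by have := sqf_graded hL b ss'; rewrite (hcB b (s : S) (s' : S)).
- move=> x s s' t t' [sK s'B ss'] [tK t'B tt']; split.
  + by apply: rpredD => //; apply: rpredZ.
  + by apply: rpredD => //; apply: rpredZ.
  + by rewrite opprD addrACA -scalerBr; apply: rpredD => //; apply: rpredZ.
- move=> s s' [sK s'B ss']; split=> //; rewrite -(submodBr ss').
  apply/idP/idP => [/(ha (s : S)) h|/(hL (s : S)) h].
    by apply/(hL (s : S)) => m /h; rewrite aE => /andP[].
  by apply/(ha (s : S)) => m ms; rewrite aE h // ((hK (s : S)).1 sK).
- move=> s sK; pose s' : S := restr (fun m => UB (msup m)) (s : S); exists s'; split=> //.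
    by apply/(hB s') => m /coeff_restr_neq0[].
  apply/(hL ((s : S) - s')) => m; rewrite coeffB coeff_restr.
  case: ifP => [_|/negbT/negbTE uB]; first by rewrite subrr eqxx.
  by rewrite subr0 => /((hK (s : S)).1 sK)/KBL; rewrite uB.
- move=> s' s'B; exists s'; split=> //; last by rewrite subrr rpred0.
  by apply/(hK (s' : S)) => m ms; apply: BK; apply: ((hB (s' : S)).1 s'B).
Qed.

End LinkedIdeals.

(** * Supports of the letterplace ideals and of the linked ideals *)

Section Letterplace.
Variables (k : fieldType) (disp : Order.disp_t) (P : finPOrderType disp) (n : nat).
Local Notation I := (var P n).
Local Notation S := (polyring k I).
Local Notation fn := {ffun P -> 'I_n}.
Implicit Types (A C : {set I}) (g : fn) (T : {set P}) (J : {set HomPn P n}).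

Definition graph g : {set I} := [set (p, g p) | p : P].
(** The support of the element f_p of the regular sequence. *)
Definition vrow p : {set I} := [set x : I | x.1 == p].

Lemma in_graph g (x : I) : (x \in graph g) = (g x.1 == x.2).
Proof.
case: x => p i; apply/imsetP/eqP => [[q _ [-> ->]] //|/= <-].
by exists p.
Qed.

Lemma graph_subP g C : reflect (forall p, (p, g p) \in C) (graph g \subset C).
Proof.
apply: (iffP subsetP) => [h p|h _ /imsetP[p _ ->] //].
by apply: h; apply: imset_f.
Qed.

Lemma graph_monoE (phi : HomPn P n) : graph_mono k phi = set_mono k (graph (val phi)).
Proof.
rewrite /set_mono /graph big_imset /= => [|p q _ _ [] //].
by apply: eq_bigl => p; rewrite inE.
Qed.

Definition fam_L J A : bool := [exists phi in J, graph (val phi) \subset A].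
Definition fam_BPn A : bool := [exists p : P, exists q : P, exists i : 'I_n, exists j : 'I_n,
  [&& (p < q)%O, (j < i)%N, (p, i) \in A & (q, j) \in A]].
Definition fam_B J A : bool := fam_L (~: J) A || fam_BPn A.

Lemma sqf_L J : sqf (L_ideal k J) (fam_L J).
Proof.
apply: (@sqf_span _ _ _ (fun A => exists2 phi : HomPn P n, phi \in J & A = graph (val phi))).
  move=> f; split=> [[phi phiJ ->]|[_ [phi phiJ ->] ->]].
    by exists (graph (val phi)); [exists phi | apply: graph_monoE].
  by exists phi => //; rewrite graph_monoE.
move=> B; split=> [/existsP[phi /andP[phiJ h]]|[_ [phi phiJ ->] h]].
  by exists (graph (val phi)) => //; exists phi.
by apply/existsP; exists phi; rewrite phiJ.
Qed.

Lemma sqf_BPn : sqf (BPn_ideal k P n) fam_BPn.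
Proof.
pose Q (A : {set I}) := exists (p q : P) (i j : 'I_n),
  [/\ (p < q)%O, (j < i)%N & A = [set (p, i); (q, j)]].
have E (p q : P) (i j : 'I_n) : (p < q)%O ->
    X_ k ((p, i) : I) * X_ k ((q, j) : I) = set_mono k [set (p, i); (q, j)].
  move=> pq; rewrite /set_mono big_setU1 /= ?big_set1 // inE.
  by apply/eqP => -[e _]; rewrite e Order.POrderTheory.ltxx in pq.
apply: (@sqf_span _ _ _ Q).
  move=> f; split=> [[p [q [i [j [pq ji ->]]]]]|[_ [p [q [i [j [pq ji ->]]]]] ->]].
    by exists [set (p, i); (q, j)]; [exists p, q, i, j | apply: E].
  by exists p, q, i, j; split=> //; rewrite E.
move=> B; split.
  move=> /existsP[p /existsP[q /existsP[i /existsP[j /and4P[pq ji pB qB]]]]].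
  exists [set (p, i); (q, j)]; first by exists p, q, i, j.
  by apply/subsetP=> x; rewrite !inE => /orP[]/eqP->.
move=> [_ [p [q [i [j [pq ji ->]]]]] /subsetP h].
apply/existsP; exists p; apply/existsP; exists q; apply/existsP; exists i.
by apply/existsP; exists j; rewrite pq ji !h ?inE ?eqxx ?orbT.
Qed.

Lemma sqf_B J : sqf (B_ideal k J) (fam_B J).
Proof. exact: sqf_addsub (sqf_L _) sqf_BPn. Qed.

Definition fam_rows T A : bool := [exists p in T, vrow p \subset A].
Definition fam_colon J A : bool :=
  [forall g : fn, [exists phi in J, val phi == g] || ~~ (graph g \subset ~: A)].

Lemma fam_colonP J A : reflect
  (forall g, graph g \subset ~: A -> exists2 phi, phi \in J & val phi = g)
  (fam_colon J A).
Proof.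
apply: (iffP forallP) => h g.
  move=> gA; have := h g; rewrite gA orbF => /existsP[phi /andP[phiJ /eqP e]].
  by exists phi.
case: (boolP (graph g \subset ~: A)) => [/h[phi phiJ e]|_]; last by rewrite orbT.
by rewrite orbF; apply/existsP; exists phi; rewrite phiJ e eqxx.
Qed.

(** A full row meets every graph. If [A] contains no full row, choosing a point outside [A] in each
    row gives a map with graph in the complement; [fam_colon] puts it in [J], against the second
    factor. *)
Lemma fam_rowsE J A :
  fam_rows setT A = fam_colon J A && ~~ fam_L J (~: A).
Proof.
apply/idP/andP.
  move=> /existsP[p /andP[_ /subsetP pA]].
  have meets g : ~~ (graph g \subset ~: A).
    by apply/negP => /graph_subP/(_ p); rewrite inE pA // inE.
  split; first by apply/fam_colonP => g; rewrite (negbTE (meets g)).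
  by apply/existsP => -[phi]; rewrite (negbTE (meets _)) andbF.
move=> [/fam_colonP cA /existsP lA]; apply: contraT => /existsP nrow.
have ex p : exists i, (p, i) \notin A.
  apply: contra_notP nrow => h; exists p; rewrite inE; apply/subsetP => -[q i].
  rewrite inE => /= /eqP ->; apply: contraT => iA; case: h; by exists i.
have [g gP] := choice ex.
have /cA[phi phiJ e] : graph [ffun p => g p] \subset ~: A.
  by apply/graph_subP => p; rewrite inE ffunE.
case: lA; exists phi; rewrite phiJ e; apply/graph_subP => p.
by rewrite inE ffunE.
Qed.

(** A map with graph in the complement of [A] is isotone, since a violated inequality would give a
    generator of B(P,n) supported there, and it is in [J], since otherwise its graph would give a
    generator of L(J^c). *)
Lemma fam_B_colon J A : ~~ fam_B J (~: A) -> fam_colon J A.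
Proof.
move=> h; apply/fam_colonP => g /graph_subP gA.
case: (boolP (isotone g)) => [gi|].
  pose phi : HomPn P n := Sub g gi; exists phi; last exact: SubK.
  apply: contraNT h => phiJ; apply/orP; left; apply/existsP; exists phi.
  by rewrite inE phiJ SubK; apply/graph_subP.
rewrite negb_forall => /existsP[p]; rewrite negb_forall => /existsP[q].
rewrite negb_imply -ltnNge => /andP[pq gqp].
case/negP: h; apply/orP; right; apply/existsP; exists p; apply/existsP; exists q.
apply/existsP; exists (g p); apply/existsP; exists (g q).
rewrite Order.POrderTheory.lt_neqAle pq gqp !gA !andbT.
by apply: contraTneq gqp => ->; rewrite ltnn.
Qed.

Lemma fam_colon_B J A : fam_colon J A -> ~~ fam_B J (~: A) || ~~ fam_L J (~: A).
Proof.
move=> /fam_colonP h; rewrite -negb_and; apply/negP => /andP[/orP[]].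
  move=> /existsP[phi /andP[phiJ /h[psi psiJ /val_inj e]]] _.
  by move: phiJ; rewrite inE -e psiJ.
move=> /existsP[p /existsP[q /existsP[i /existsP[j /and4P[pq ji pA qA]]]]].
move=> /existsP[phi /andP[_ /graph_subP phiA]].
(* Rerouting [phi] through the inverted pair keeps the graph in the complement but makes the map
   non-isotone, so it cannot be in [J]. *)
pose g : fn := [ffun x => if x == p then i else if x == q then j else val phi x].
have /h[psi _ e] : graph g \subset ~: A.
  apply/graph_subP => x; rewrite ffunE.
  by case: (x =P p) => [->|_] //; case: (x =P q) => [->|_].
have /forallP/(_ p)/forallP/(_ q) := valP psi.
rewrite e !ffunE eqxx (Order.POrderTheory.ltW pq) /=.
have qp : (q == p) = false.
  by apply/eqP => e'; rewrite e' Order.POrderTheory.ltxx in pq.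
by rewrite qp eqxx leqNgt ji.
Qed.

Lemma row_subU p q A : p != q -> vrow q \subset vrow p :|: A -> vrow q \subset A.
Proof.
move=> pq /subsetP h; apply/subsetP => x xq; have := h x xq.
by move: xq; rewrite !inE => /eqP ->; rewrite eq_sym (negbTE pq).
Qed.

Lemma rows_degree : \sum_(p : P) degm (mset (vrow p)) = ones I.
Proof.
apply/ffunP => -[p i]; rewrite sum_ffunE ffunE (bigD1 p) //= big1 ?addr0.
  by rewrite ffunE msetE inE eqxx.
by move=> q qp; rewrite ffunE msetE inE /= eq_sym (negbTE qp).
Qed.

Section Canonical.
Variables (J : {set HomPn P n}) (W : ideal k I).
Hypothesis WJ : sqf W (fun A => ~~ fam_L J (~: A)).
Variable F : free_resolution (gquot W).

Lemma canonical_module (B L : ideal k I) :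
  sqf B (fun A => ~~ fam_B J (~: A)) -> sqf L (fun A => ~~ fam_L J (~: A)) ->
  graded_iso (Ext F (shifted k (ones I)) #|P|) (natural_image (M := Sgr k I) B L).
Proof.
move=> hB hL.
have [g gP] := aug_lift F.
have /choice[a aP] : forall T, exists a, sqf (k := k) a (fam_rows T).
  move=> T; apply: sqf_exists => A C AC /existsP[p /andP[pT h]].
  by apply/existsP; exists p; rewrite pT (subset_trans h).
have [K KP] : exists K, sqf (k := k) K (fam_colon J).
  apply: sqf_exists => A C AC /fam_colonP h; apply/fam_colonP => f fC.
  by apply: h; apply: subset_trans fC _; rewrite setCS.
have a_graded T : graded_ideal (a T) := sqf_graded (aP T).
have rowW p : (set_mono k (vrow p) : Sgr k I) \in W.
  rewrite set_monoE; apply/(sqf_mono _ WJ); rewrite msup_mset.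
  apply/existsP => -[phi /andP[_ /graph_subP/(_ p)]].
  by rewrite !inE eqxx.
have a0 x : (x : Sgr k I) \in a set0 <-> x = 0.
  rewrite (aP set0 x); split=> [h|-> m]; last by rewrite coeff0 eqxx.
  apply/coeffP=> m; rewrite coeff0; apply/eqP/negPn/negP => /h/existsP[p].
  by rewrite inE.
have reg p T : p \notin T -> forall x : S,
    (set_mono k (vrow p) * x : Sgr k I) \in a T -> (x : Sgr k I) \in a T.
  move=> pT x /(sqf_monoM _ _ (aP T)) h; apply/(aP T x) => m /h/existsP[q /andP[qT hq]].
  apply/existsP; exists q; rewrite qT; apply: row_subU hq.
  by apply: contraNneq pT => ->.
have aU p T : p \notin T -> forall x : S, (x : Sgr k I) \in a (p |: T) <->
    exists y z : S, (y : Sgr k I) \in a T /\ x = y + set_mono k (vrow p) * z.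
  move=> pT x; rewrite (aP _ x); split=> [h|[y [z [/(aP T y) yT ->]]] m].
    (* [y] collects the monomials containing a full row from [T]. Each remaining monomial contains
       the row of [p], hence is divisible by f_p. *)
    pose y := restr (k := k) (fun m => fam_rows T (msup m)) x.
    have [z zE] : exists z, x - y = set_mono k (vrow p) * z.
      apply: set_mono_dvd => m; rewrite coeffB coeff_restr.
      case: ifP => [_|/negbT nT]; first by rewrite subrr eqxx.
      rewrite subr0 => /h/existsP[q /andP[]]; rewrite !inE => /orP[/eqP -> //|qT hq].
      by case/negP: nT; apply/existsP; exists q; rewrite qT.
    exists y, z; split; last by rewrite -zE addrC subrK.
    by apply/(aP T y) => m /coeff_restr_neq0[].
  case/coeffD_neq0=> [/yT/existsP[q /andP[qT hq]]|].
    by apply/existsP; exists q; rewrite !inE qT orbT.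
  rewrite set_monoE => /coeff_monoM_neq0[m' _ ->].
  by apply/existsP; exists p; rewrite !inE eqxx msupM msup_mset subsetUl.
have KE s : (s : Sgr k I) \in K <->
    forall h : S, (h : Sgr k I) \in W -> (h * s : Sgr k I) \in a setT.
  split=> [/(KP s) sK h /(WJ h) hW|hs].
    apply/(aP setT (h * s)) => m /coeffM_neq0[m1 [m2 [/hW h1 /sK s2 ->]]].
    rewrite (fam_rowsE J) msupM; apply/andP; split.
      exact: sqf_up KP (subsetUr _ _) s2.
    exact: (sqf_up (A := msup m1) WJ (subsetUl _ _) h1).
  apply/(KP s) => m ms; apply/fam_colonP => f /graph_subP fm.
  have [//|nJ] := EM (exists2 phi, phi \in J & val phi = f).
  (* Test with the complement of the graph of [f]: it meets every graph except that of [f], so it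
     lies in [W] when [f] is not in [J]. A full row in the product then forces some [(p, f p)] into
     the support of [m]. *)
  have /hs/(sqf_monoM _ _ (aP setT))/(_ m ms) :
      (set_mono k (~: graph f) : Sgr k I) \in W.
    rewrite set_monoE; apply/(sqf_mono _ WJ); rewrite msup_mset setCK.
    apply/existsP => -[phi /andP[phiJ /graph_subP h]]; apply: nJ; exists phi => //.
    by apply/ffunP => p; have := h p; rewrite in_graph => /eqP.
  move=> /existsP[p /andP[_ /subsetP/(_ (p, f p))]].
  rewrite !inE eqxx in_graph eqxx /= => /(_ isT) pm.
  by have := fm p; rewrite !inE pm.
have htpy p := aug_htpy (fun v => (gP v).2) (rowW p).
have piece_row p : poly_piece (degm (mset (vrow p))) (set_mono k (vrow p)).
  by rewrite set_monoE; apply: poly_piece_mono.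
apply: graded_iso_trans (Ext_cohom F (ones I) a0 #|P|) _.
apply: graded_iso_trans (regular_cohom piece_row htpy reg aU a_graded _ _) _.
  by rewrite cards0 addn0.
have -> : - ones I + \sum_(p in ~: set0) degm (mset (vrow p)) = 0.
  rewrite -rows_degree [X in _ + X](eq_bigl xpredT) ?addNr // => p.
  by rewrite !inE.
apply: graded_iso_trans (cohom0_colon (fun v => (gP v).1) (fun v => (gP v).2)
  (a_graded setT) (sqf_graded KP) KE) _.
apply: natural_image_linked KP (aP setT) hB hL _ _ _.
- exact: fam_B_colon.
- exact: fam_colon_B.
- exact: fam_rowsE.
Qed.

End Canonical.
End Letterplace.

Theorem corollary4p3 (k : fieldType) (disp : Order.disp_t)
    (P : finPOrderType disp) (n : nat) (J : {set HomPn P n})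
    (F : free_resolution (sr_ring k (Delta k J))) :
  poset_ideal J ->
  let omega := Ext F (shifted k (ones (var P n))) #|P| in
  let LJ := L_ideal k J in
  let BJ := B_ideal k J in
  let LJA := dual_ideal LJ in
  let BJA := dual_ideal BJ in
  [/\ (alexander_dual omega (natural_image LJ BJ)
       /\ forall D, alexander_dual omega D -> graded_iso D (natural_image LJ BJ)),
      (sr_ideal k (Delta k J) =i LJA
       /\ graded_iso omega (natural_image BJA LJA)),
      (forall D, alexander_dual omega D -> identifies_as_ideal D BJ)
    & identifies_as_ideal omega LJA].
Proof.
move=> _ omega LJ BJ LJA BJA.
have hL : sqf LJ (fam_L J) by exact: sqf_L.
have hB : sqf BJ (fam_B J) by exact: sqf_B.
have hLA := sqf_dual hL; have hBA := sqf_dual hB.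
have hsr : sqf (sr_ideal k (Delta k J)) (fun A => ~~ fam_L J (~: A)) := sqf_sr hLA.
have iso : graded_iso omega (natural_image BJA LJA) := canonical_module hsr F hBA hLA.
have compl A : fam_L J A && ~~ fam_B J A =
    ~~ fam_B J (~: ~: A) && ~~ ~~ fam_L J (~: ~: A).
  by rewrite setCK negbK andbC.
have dual := natural_image_dual hBA hLA hL hB compl.
have uniq D : alexander_dual omega D -> graded_iso D (natural_image LJ BJ).
  move=> /(alexander_dual_iso (graded_iso_sym iso)).
  exact: (dual_unique hBA hLA hL hB compl).
split.
- by split; [apply: alexander_dual_iso dual | exact: uniq].
- by split=> //; apply: sqf_ext hsr hLA.
(* [natural_image] is by definition a submodule of the quotient ring, namely the range of the
   natural map, so the isomorphism found above is already the identification. *)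
- by move=> D /uniq; exists (range_sub (@natural_map _ (Sgr k (var P n)) LJ BJ)).
- by exists (range_sub (@natural_map _ (Sgr k (var P n)) BJA LJA)).
Qed.
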